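(* Fix $1<p<\infty$ and $q=p/(p-1)$. There is an explicit deterministic method whose numerical inputs are only $$p,\ d,\ \varepsilon,\ x_0,\ z_0,\ M_0$$ (so it is given neither $L$, nor $R$, nor $\min f$) and which, for every objective $f$ in the class described in the context, returns an actually queried point $\widehat x$ satisfying $\|\nabla f(\widehat x)\|_q\le\varepsilon$. Its number $N_{\rm or}$ of pair-oracle calls after initialization satisfies $$N_{\rm or}\le C_p\,\overline K^{1/2}+C_p\log\left(e+\frac{L}{M_0}\right)\quad\text{if }1<p<2,$$ $$N_{\rm or}\le C\,\overline K^{1/2}+C\log\left(e+\frac{L}{M_0}\right)\quad\text{if }p=2,$$ $$N_{\rm or}\le C_p\,\overline K^{\frac{p}{p+2}}+C_p\log\left(e+\frac{L}{M_0}\right)\quad\text{if }2<p<\infty.$$ Here $C$ is universal and $C_p$ depends only on the fixed exponent $p$; none of these constants has polynomial dependence on $d$.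
   Context: Objective class: $f:\mathbb R^d\to\mathbb R$ is differentiable and convex, $X^*:=\operatorname{argmin}f\neq\varnothing$, and $\|\nabla f(x)-\nabla f(y)\|_q\le L\|x-y\|_p$ for all $x,y\in\mathbb R^d$. For an initial point $x_0\in\mathbb R^d$ and target accuracy $\varepsilon>0$ put $$R:=\operatorname{dist}_p(x_0,X^* )=\inf_{x\in X^*}\|x-x_0\|_p,\qquad K:=\frac{LR}{\varepsilon},\qquad \overline K:=\max\{1,K\}.$$ Post-initialization secant model: in addition to $x_0$ the method receives a point $z_0\ne x_0$ with $\nabla f(z_0)\neq\nabla f(x_0)$ and the number $$M_0:=\frac{\|\nabla f(z_0)-\nabla f(x_0)\|_q}{\|z_0-x_0\|_p}>0.$$ The cost of discovering $z_0$ is not counted. Afterwards each pair-oracle call at a point $x$ returns the exact pair $(f(x),\nabla f(x))$ and every such call is counted. The method accesses $f$ only through these calls (besides $z_0,M_0$), and each query is a deterministic function of the inputs and the previously returned pairs. *)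

(* Defs.v *)
From mathcomp Require Import all_boot all_order all_algebra.
From mathcomp Require Import all_classical all_reals all_analysis.

Set Implicit Arguments.
Unset Strict Implicit.
Unset Printing Implicit Defensive.

Import Order.TTheory GRing.Theory Num.Theory.
Import numFieldNormedType.Exports.

Local Open Scope classical_set_scope.
Local Open Scope ring_scope.

(* The canonical norm `|x| on 'rV[R]_d is the sup norm; it is used only as the
   (norm-independent) topology behind [differentiable]. *)
Definition lp_norm (R : realType) (p : R) (d : nat) (x : 'rV[R]_d) : R :=
  (\sum_(i < d) `|x 0 i| `^ p) `^ p^-1.

Definition gradient (R : realType) (d : nat) (f : 'rV[R]_d -> R)
    (x : 'rV[R]_d) : 'rV[R]_d :=
  \row_(i < d) 'd f x (delta_mx 0 i).

Definition argmin (R : realType) (d : nat) (f : 'rV[R]_d -> R) :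
    set 'rV[R]_d :=
  [set x | forall y, f x <= f y].

(* [inf] is total; it is the infimum here because [A] is nonempty wherever this
   is used, and distances are bounded below by 0. *)
Definition lp_dist (R : realType) (p : R) (d : nat) (x0 : 'rV[R]_d)
    (A : set 'rV[R]_d) : R :=
  inf [set lp_norm p (x - x0) | x in A].

Definition objective_class (R : realType) (p q L : R) (d : nat)
    (f : 'rV[R]_d -> R) : Prop :=
  [/\ forall x, differentiable f x,
      convex_function [set: 'rV[R]_d] f,
      argmin f !=set0 &
      forall x y, lp_norm q (gradient f x - gradient f y)
                  <= L * lp_norm p (x - y)].

Definition secant_ratio (R : realType) (p q : R) (d : nat)
    (f : 'rV[R]_d -> R) (x0 z0 : 'rV[R]_d) : R :=
  lp_norm q (gradient f z0 - gradient f x0) / lp_norm p (z0 - x0).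

Definition pair_oracle (R : realType) (d : nat) (f : 'rV[R]_d -> R)
    (x : 'rV[R]_d) : R * 'rV[R]_d :=
  (f x, gradient f x).

Variant action (R : realType) (d : nat) : Type :=
  | Query of 'rV[R]_d
  | Return of 'rV[R]_d.
Arguments Query {R d} _.
Arguments Return {R d} _.

(* The next move as a function of the oracle answers received so far, oldest
   first. *)
Definition protocol (R : realType) (d : nat) : Type :=
  seq (R * 'rV[R]_d) -> action R d.

(* The numerical inputs are, in this order, p, d, epsilon, x0, z0, M0. *)
Definition method (R : realType) : Type :=
  forall (p : R) (d : nat) (eps : R) (x0 z0 : 'rV[R]_d) (M0 : R),
    protocol R d.

(* Run against the oracle [O], the protocol [S] queries exactly the points [qs],
   in this order and with repetitions, and then returns [xhat]; so [size qs] is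
   the number of oracle calls. *)
Definition halts_with (R : realType) (d : nat) (S : protocol R d)
    (O : 'rV[R]_d -> R * 'rV[R]_d) (qs : seq 'rV[R]_d) (xhat : 'rV[R]_d) :
    Prop :=
  (forall i, (i < size qs)%N -> S (map O (take i qs)) = Query (nth 0 qs i))
  /\ S (map O qs) = Return xhat.

(* Main.v *)
Require Import Defs.
From mathcomp Require Import all_boot all_order all_algebra.
From mathcomp Require Import all_classical all_reals all_analysis.
From mathcomp Require Import ring lra.

Import Order.TTheory GRing.Theory Num.Theory.
Import numFieldNormedType.Exports.

Local Open Scope classical_set_scope.
Local Open Scope ring_scope.

Set Implicit Arguments.
Unset Strict Implicit.
Unset Printing Implicit Defensive.

(** The method works with a guess M of the smoothness constant and a guess
    r = 2 ^ i * eps / M of the distance from x0 to a minimizer.  A run for (M, i)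
    makes O((2 ^ i) ^ (m / (m + 2))) oracle calls, where m = max p 2, and ends in
    one of three ways: it finds a point with gradient of norm at most eps, or it
    sees two queried points whose gradients violate the Lipschitz bound M, or it
    refutes r, in the sense that all minimizers are at distance more than r
    ([runP]).  A violated Lipschitz bound doubles M, a refuted radius doubles r.
    Once some radius has been refuted, every restart increments i, so the costs
    form a geometric series dominated by its last term, and the last i satisfies
    2 ^ i <= 4 K because M is at most 2 L and r at most twice the distance.  Before
    that, i = 0 and each restart costs a constant and doubles M, which happens
    O(1 + log (L / M0)) times.  This gives the additive logarithm
    ([outer_halts], [spent_le]).

    Inside a run the objective f is regularized by accumulation.  In stage s the
    term sigma_s * |z - x_s| ^ m, centred at the current point, is added to the
    regularizer h, and the sum f + h is minimized approximately, starting from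
    x_s.  As the new term is centred at x_s, the new minimizer is no further from x_s
    than the previous one; as the lp norm is uniformly convex of degree m
    ([lp_norm_uniform_convex]), a small function gap makes the bound on the
    distance to the minimizer four times smaller at x_{s+1} ([stage_step]).  The
    weights sigma_s grow slowly enough that the slopes of all the added terms sum
    to at most eps / 3, and quickly enough that the iteration counts of the stages
    decrease geometrically.  After i + 1 stages the last point is so close to a
    minimizer of f + h that one trial step in the direction dual to the gradient
    bounds the gradient of f by eps.

    Each stage runs an accelerated method on f + h in the lp geometry ([accel]).
    It keeps a lower model phi of A_k (f + h) + |z - c| ^ m, whose minimizer
    yields the next query.  Uniform convexity of degree m pays for the quadratic
    error of smoothness up to a fixed amount per step ([powR_young]); with a
    horizon of n steps this yields the gap O(M D ^ 2 / n ^ ((m + 2) / m)), the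
    right rate on both sides of p = 2.  The only consequence of smoothness that
    the analysis uses is a gradient bound between consecutive queried points
    ([descent]), and the method can verify it; hence no knowledge of L is needed.

    The algorithm is analysed over an abstract [geometry], of which lp is an
    instance. *)

(** * Real powers and lp norms *)

Lemma ler_powR_base (R : realType) (r a b : R) :
  0 <= r -> 0 <= a -> a <= b -> a `^ r <= b `^ r.
Proof.
by move=> r0 a0 ab; apply: ge0_ler_powR; rewrite ?nnegrE// (le_trans a0).
Qed.

Lemma powRVl (R : realType) (a r : R) : 0 <= a -> a^-1 `^ r = (a `^ r)^-1.
Proof.
by move=> a0; rewrite -powR_inv1// powRAC powR_inv1// powR_ge0.
Qed.

Lemma powR_convex (R : realType) (r t a b : R) :
  1 <= r -> 0 <= t -> t <= 1 -> 0 <= a -> 0 <= b ->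
  (t * a + (1 - t) * b) `^ r <= t * a `^ r + (1 - t) * b `^ r.
Proof.
move=> r1 t0 t1 a0 b0.
have := @convex_powR R r r1 (Itv01 t0 t1) a b; rewrite !inE/= !in_itv/= !andbT.
by move=> /(_ a0 b0); rewrite !convRE.
Qed.

Section LpNorm.
Variables (R : realType) (p : R) (d : nat).
Hypothesis p1 : 1 <= p.
Local Notation n := (@lp_norm R p d).
Implicit Types (x y z : 'rV[R]_d) (t : R).

Let p0 : 0 < p. Proof. exact: lt_le_trans ltr01 p1. Qed.
Let p_neq0 : p != 0. Proof. by rewrite gt_eqF. Qed.

Lemma lp_norm_ge0 x : 0 <= n x. Proof. exact: powR_ge0. Qed.

Lemma lp_sum_ge0 x : 0 <= \sum_(i < d) `|x 0 i| `^ p.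
Proof. by apply: sumr_ge0 => i _; exact: powR_ge0. Qed.

Lemma lp_norm_powR x : n x `^ p = \sum_(i < d) `|x 0 i| `^ p.
Proof. by rewrite /lp_norm -powRrM mulVf// powRr1// lp_sum_ge0. Qed.

Lemma lp_norm_le x t : 0 <= t -> \sum_(i < d) `|x 0 i| `^ p <= t `^ p -> n x <= t.
Proof.
move=> t0 h; rewrite -[t]powRr1// -(mulfV p_neq0) powRrM.
by apply: ler_powR_base => //; [rewrite invr_ge0 ltW | exact: lp_sum_ge0].
Qed.

Lemma lp_norm0 : n 0 = 0.
Proof.
apply/le_anti; rewrite lp_norm_ge0 andbT; apply: lp_norm_le => //.
by rewrite big1 ?powR_ge0// => i _; rewrite mxE normr0 powR0.
Qed.

Lemma lp_normZ t x : n (t *: x) = `|t| * n x.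
Proof.
rewrite /lp_norm (eq_bigr (fun i => `|t| `^ p * `|x 0 i| `^ p)); last first.
  by move=> i _; rewrite mxE normrM powRM.
by rewrite -mulr_sumr powRM ?powR_ge0 ?lp_sum_ge0// -powRrM mulfV// powRr1.
Qed.

Lemma lp_normN x : n (- x) = n x.
Proof. by rewrite -scaleN1r lp_normZ normrN1 mul1r. Qed.

Lemma lp_normC x y : n (x - y) = n (y - x).
Proof. by rewrite -lp_normN opprB. Qed.

Lemma le_coord_lp_norm x i : `|x 0 i| <= n x.
Proof.
rewrite leNgt; apply/negP => h.
have := gt0_ltr_powR p0 (lp_norm_ge0 x) (normr_ge0 (x 0 i)) h.
by rewrite lp_norm_powR (bigD1 i)//= ltNge lerDl sumr_ge0// => j _; exact: powR_ge0.
Qed.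

Lemma lp_norm_eq0 x : n x = 0 -> x = 0.
Proof.
move=> x0; apply/rowP => i; rewrite mxE; apply/eqP; rewrite -normr_le0 -x0.
exact: le_coord_lp_norm.
Qed.

(** Minkowski from convexity of the power: after scaling, (x + y) / (a + b) is the
    convex combination of the unit vectors x / a and y / b with weights
    a / (a + b) and b / (a + b). *)
Lemma ler_lp_normD x y : n (x + y) <= n x + n y.
Proof.
have [/lp_norm_eq0->|x0] := eqVneq (n x) 0; first by rewrite add0r lerDr lp_norm_ge0.
have [/lp_norm_eq0->|y0] := eqVneq (n y) 0; first by rewrite addr0 lerDl lp_norm_ge0.
have nx : 0 < n x by rewrite lt_neqAle eq_sym x0 lp_norm_ge0.
have ny : 0 < n y by rewrite lt_neqAle eq_sym y0 lp_norm_ge0.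
move: (lp_norm_powR x) (lp_norm_powR y) nx ny {x0 y0}.
move: (n x) (n y) => a b Ea Eb a0 b0.
have ab0 : 0 < a + b := addr_gt0 a0 b0.
apply: lp_norm_le; first exact: ltW.
pose t := a / (a + b).
have t0 : 0 <= t := divr_ge0 (ltW a0) (ltW ab0).
have t1 : 1 - t = b / (a + b) by rewrite /t; field; rewrite gt_eqF.
have t1_ge0 : 0 <= 1 - t by rewrite t1; exact: divr_ge0 (ltW b0) (ltW ab0).
have Hi i : `|(x + y) 0 i| `^ p <= (a + b) `^ p *
   (t * (`|x 0 i| `^ p / a `^ p) + (1 - t) * (`|y 0 i| `^ p / b `^ p)).
  have xa0 : 0 <= `|x 0 i| / a := divr_ge0 (normr_ge0 _) (ltW a0).
  have yb0 : 0 <= `|y 0 i| / b := divr_ge0 (normr_ge0 _) (ltW b0).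
  rewrite -!powRVl ?(ltW a0) ?(ltW b0)// -!powRM ?invr_ge0 ?(ltW a0) ?(ltW b0)//.
  have s0 : 0 <= t * (`|x 0 i| / a) + (1 - t) * (`|y 0 i| / b).
    by rewrite addr_ge0// mulr_ge0.
  apply: (le_trans (y := (a + b) `^ p * (t * (`|x 0 i| / a) + (1 - t) * (`|y 0 i| / b)) `^ p)).
    rewrite -powRM ?(ltW ab0)//; apply: ler_powR_base; rewrite ?(ltW p0)//.
    rewrite mxE; apply: le_trans (ler_normD _ _) _; rewrite t1 /t le_eqVlt.
    by apply/orP; left; apply/eqP; field; rewrite !gt_eqF.
  by rewrite ler_pM2l ?powR_gt0//; apply: powR_convex => //; rewrite -subr_ge0.
apply: le_trans (ler_sum _ (fun i _ => Hi i)) _.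
rewrite -mulr_sumr big_split/= -!mulr_sumr -!mulr_suml -Ea -Eb.
rewrite !divff ?gt_eqF ?powR_gt0//; have := powR_ge0 (a + b) p.
by rewrite !mulr1 addrC subrK mulr1.
Qed.

Lemma lp_norm_dist x y : `|n x - n y| <= n (x - y).
Proof.
rewrite ler_norml lerBlDr lerNl opprB lerBlDr; apply/andP; split.
  by rewrite lp_normC -{1}[y](subrK x) ler_lp_normD.
by rewrite -{1}[x](subrK y) ler_lp_normD.
Qed.

Lemma ler_lp_norm_sum (I : Type) (s : seq I) (F : I -> 'rV[R]_d) :
  n (\sum_(i <- s) F i) <= \sum_(i <- s) n (F i).
Proof.
elim/big_ind2 : _ => [|x a y b xa yb|//]; first by rewrite lp_norm0.
by apply: le_trans (ler_lp_normD _ _) _; exact: lerD.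
Qed.

(** This bound and the next one compare the lp norm with the sup norm that carries
    the topology of row vectors; they give continuity and compact balls. *)
Lemma lp_norm_le_mx_norm x : n x <= d%:R `^ p^-1 * `|x|.
Proof.
apply: lp_norm_le; first by rewrite mulr_ge0// powR_ge0.
rewrite powRM ?powR_ge0// -powRrM mulVf// powRr1//.
apply: (le_trans (y := \sum_(i < d) `|x| `^ p)); last first.
  by rewrite sumr_const card_ord mulr_natl.
apply: ler_sum => i _; apply: ler_powR_base; rewrite ?(ltW p0)//.
by rewrite [leRHS]/Num.Def.normr/= mx_normrE; apply/bigmax_geP; right; exists (0, i).
Qed.

Lemma mx_norm_le_lp_norm x : `|x| <= n x.
Proof.
rewrite [leLHS]/Num.Def.normr/= mx_normrE; apply/bigmax_leP; split => [|[i j] _ /=].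
  exact: lp_norm_ge0.
by rewrite ord1 le_coord_lp_norm.
Qed.

Lemma lp_norm_continuous : continuous n.
Proof.
move=> x; apply/(@cvgrPdist_le _ _ _ (nbhs x)) => e e0.
have K0 : 0 < d%:R `^ p^-1 + 1 by rewrite ltr_wpDl// powR_ge0.
near=> y.
apply: le_trans (lp_norm_dist _ _) _.
apply: le_trans (lp_norm_le_mx_norm _) _.
apply: (le_trans (y := (d%:R `^ p^-1 + 1) * `|x - y|)).
  by apply: ler_wpM2r => //; rewrite lerDl.
rewrite mulrC -ler_pdivlMr//; near: y.
by apply: cvgr_dist_le => //; rewrite divr_gt0.
Unshelve. all: by end_near. Qed.

End LpNorm.

(** * The duality pairing and Hoelder's inequality *)

Section Pairing.
Variables (R : realType) (d : nat).
Implicit Types g x : 'rV[R]_d.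

Definition dot g x : R := \sum_(i < d) g 0 i * x 0 i.

Lemma dotDr g x y : dot g (x + y) = dot g x + dot g y.
Proof. by rewrite -big_split; apply: eq_bigr => i _; rewrite mxE mulrDr. Qed.

Lemma dotZr g t x : dot g (t *: x) = t * dot g x.
Proof. by rewrite mulr_sumr; apply: eq_bigr => i _; rewrite mxE mulrCA. Qed.

Lemma dotBl g h x : dot (g - h) x = dot g x - dot h x.
Proof. by rewrite -sumrB; apply: eq_bigr => i _; rewrite !mxE mulrBl. Qed.

Variables p q : R.
Hypotheses (p1 : 1 < p) (q1 : 1 < q) (pq : p^-1 + q^-1 = 1).
Let p0 : 0 < p. Proof. exact: lt_trans ltr01 p1. Qed.
Let q0 : 0 < q. Proof. exact: lt_trans ltr01 q1. Qed.

Lemma dot_le_lp_norm g x : dot g x <= lp_norm q g * lp_norm p x.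
Proof.
have [/(lp_norm_eq0 (ltW p1))->|x0] := eqVneq (lp_norm p x) 0.
  by rewrite -(scale0r 0) dotZr mul0r mulr_ge0// lp_norm_ge0.
have [/(lp_norm_eq0 (ltW q1))->|g0] := eqVneq (lp_norm q g) 0.
  by rewrite -(subrr 0) dotBl !subrr lp_norm0 ?mul0r// ltW.
have nx : 0 < lp_norm p x by rewrite lt_neqAle eq_sym x0 lp_norm_ge0.
have ng : 0 < lp_norm q g by rewrite lt_neqAle eq_sym g0 lp_norm_ge0.
move: (lp_norm_powR (ltW p1) x) (lp_norm_powR (ltW q1) g) nx ng {x0 g0}.
move: (lp_norm p x) (lp_norm q g) => a b Ea Eb a0 b0.
rewrite -[leRHS]mulr1 -ler_pdivrMl ?(mulr_gt0 b0 a0)//.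
apply: (le_trans (y := \sum_(i < d) ((`|x 0 i| / a) `^ p / p + (`|g 0 i| / b) `^ q / q))).
  rewrite mulr_sumr; apply: ler_sum => i _.
  have xa0 : 0 <= `|x 0 i| / a := divr_ge0 (normr_ge0 _) (ltW a0).
  have gb0 : 0 <= `|g 0 i| / b := divr_ge0 (normr_ge0 _) (ltW b0).
  apply: le_trans (conjugate_powR xa0 gb0 p0 q0 pq).
  apply: le_trans (ler_norm _) _; rewrite !normrM normfV (gtr0_norm (mulr_gt0 b0 a0)).
  by rewrite le_eqVlt; apply/orP; left; apply/eqP; field; rewrite !gt_eqF.
rewrite big_split/= -!mulr_suml.
rewrite (eq_bigr (fun i => `|x 0 i| `^ p * (a `^ p)^-1)); last first.
  by move=> i _; rewrite powRM ?invr_ge0 ?(ltW a0)// powRVl// ltW.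
rewrite [X in _ + X / _](eq_bigr (fun i => `|g 0 i| `^ q * (b `^ q)^-1)); last first.
  by move=> i _; rewrite powRM ?invr_ge0 ?(ltW b0)// powRVl// ltW.
rewrite -!mulr_suml -Ea -Eb !mulfV ?gt_eqF ?powR_gt0//.
by rewrite !mul1r pq.
Qed.

(** The unit vector at which Hoelder's inequality for g is an equality. *)
Definition dual_direction g : 'rV[R]_d :=
  (lp_norm q g `^ (q - 1))^-1 *: \row_i (Num.sg (g 0 i) * `|g 0 i| `^ (q - 1)).

Lemma dual_directionP g :
  lp_norm p (dual_direction g) <= 1 /\ dot g (dual_direction g) = lp_norm q g.
Proof.
have q1p : (q - 1) * p = q.
  have -> : q - 1 = q / p.
    have := congr1 (fun z => q * z) pq.
    by rewrite mulrDr mulfV ?gt_eqF// mulr1 => h; apply/eqP; rewrite subr_eq h.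
  by rewrite divfK// gt_eqF.
have q1_neq0 : q - 1 != 0 by rewrite subr_eq0 gt_eqF.
have [g0|g0] := eqVneq (lp_norm q g) 0.
  have -> : dual_direction g = 0.
    by rewrite /dual_direction g0 powR0// invr0 scale0r.
  by rewrite lp_norm0 ?ltW// -(scale0r 0) dotZr mul0r g0.
have ng : 0 < lp_norm q g by rewrite lt_neqAle eq_sym g0 lp_norm_ge0.
split.
  have ngq : 0 < lp_norm q g `^ (q - 1) := powR_gt0 _ ng.
  rewrite lp_normZ ?(ltW p1)// ger0_norm ?invr_ge0 ?(ltW ngq)//.
  rewrite ler_pdivrMl// mulr1.
  apply: (lp_norm_le (ltW p1)); first exact: ltW.
  rewrite -powRrM q1p (lp_norm_powR (ltW q1)).
  apply: ler_sum => i _; rewrite mxE normrM normr_sg norm_powR// normr_id.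
  have [->|gi0] := eqVneq (g 0 i) 0; first by rewrite normr0 mul0r !powR0 ?gt_eqF.
  by rewrite mul1r -powRrM q1p.
rewrite /dual_direction dotZr.
have -> : dot g (\row_i (Num.sg (g 0 i) * `|g 0 i| `^ (q - 1))) = lp_norm q g `^ q.
  rewrite (lp_norm_powR (ltW q1)); apply: eq_bigr => i _.
  by rewrite mxE mulrA [_ * Num.sg _]mulrC -normrEsg mulr_powRB1.
by rewrite -(mulr_powRB1 (ltW ng) q0) mulrCA mulVf ?mulr1// gt_eqF// powR_gt0.
Qed.
End Pairing.

(** * Uniform convexity of the lp norm *)

Section UniformConvexity.
Variable R : realType.
Implicit Types (p r s t a b u v x y : R).

Lemma powR_le_affine s x : 0 < s < 1 -> 0 <= x -> x `^ s <= s * x + (1 - s).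
Proof.
move=> /andP[s0 s1] x0.
have s1' : 0 < 1 - s by rewrite subr_gt0.
have := @conjugate_powR R (x `^ s) 1 s^-1 (1 - s)^-1 (powR_ge0 _ _) ler01.
rewrite !invr_gt0 !invrK => /(_ s0 s1').
rewrite [s + _]addrC subrK => /(_ erefl).
by rewrite -powRrM mulfV ?gt_eqF// powRr1// powR1 mulr1 mul1r mulrC.
Qed.

(** A second-order Bernoulli inequality.  Bounding x ^ (1 - r) by its tangent
    D = (1 - r) x + r gives x ^ (1 + r) >= x ^ 2 / D, and with y = x - 1 one has
    x ^ 2 = (1 + (1 + r) y) D + r ^ 2 y ^ 2, where D <= 2. *)
Lemma powR_ge_quadratic r x : 0 < r < 1 -> 0 <= x <= 2 ->
  1 + (1 + r) * (x - 1) + r ^+ 2 / 2 * (x - 1) ^+ 2 <= x `^ (1 + r).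
Proof.
move=> /andP[r0 r1] /andP[]; rewrite le_eqVlt => /orP[/eqP<- _|x0 x2].
  rewrite powR0; last by rewrite gt_eqF// addr_gt0.
  by have := mulr_gt0 r0 r0; nra.
have -> : x `^ (1 + r) = x ^+ 2 / x `^ (1 - r).
  rewrite -powR_mulrn ?ltW// -powRB; first by congr (_ `^ _); ring.
  by apply/implyP => _; rewrite gt_eqF.
have r01 : 0 < 1 - r < 1 by apply/andP; split; lra.
have h := powR_le_affine r01 (ltW x0).
have h0 : 0 < x `^ (1 - r) := powR_gt0 _ x0.
rewrite ler_pdivlMr//; move: h h0; move: (x `^ _) => D h h0.
have D2 : D <= 2 by apply: le_trans h _; nra.
have [h1|h1] := leP 0 (1 + (1 + r) * (x - 1) + r ^+ 2 / 2 * (x - 1) ^+ 2); last first.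
  by apply: (le_trans (y := 0)); [rewrite ltW// pmulr_llt0|exact: sqr_ge0].
apply: le_trans (ler_wpM2l h1 h) _.
have : 0 <= r ^+ 2 * (x - 1) ^+ 2 * (2 - ((1 - r) * x + (1 - (1 - r)))).
  apply: mulr_ge0; first by rewrite mulr_ge0 ?sqr_ge0.
  by rewrite subr_ge0; nra.
nra.
Qed.

(** For u = 1 and v = t in [-1, 1], the linear terms of [powR_ge_quadratic] at
    1 + t and 1 - t cancel, which leaves 1 + (p - 1) ^ 2 / 2 * t ^ 2; being at least
    1, this is no smaller than its power p / 2. *)
Lemma two_point_dominated p u v : 1 < p < 2 -> `|v| <= `|u| ->
  (u ^+ 2 + (p - 1) ^+ 2 / 2 * v ^+ 2) `^ (p / 2)
    <= (`|u + v| `^ p + `|u - v| `^ p) / 2.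
Proof.
move=> /andP[p1 p2] vu; have p0 : 0 < p by lra.
have [u0|u0] := eqVneq u 0.
  move: vu; rewrite u0 normr0 normr_le0 => /eqP->.
  by rewrite subrr addr0 normr0 expr0n/= mulr0 addr0 !powR0 ?gt_eqF ?divr_gt0// addr0 mul0r.
have u0' : `|u| != 0 by rewrite normr_eq0.
pose t := v / u.
have t1 : `|t| <= 1 by rewrite normrM normfV ler_pdivrMr ?normr_gt0// mul1r.
have vE : v = t * u by rewrite /t divfK.
have /andP[tm1 tp1] : -1 <= t <= 1 by rewrite -ler_norml.
set c := (p - 1) ^+ 2 / 2.
have c0 : 0 <= c by rewrite divr_ge0// sqr_ge0.
have ct0 : 0 <= c * t ^+ 2 by rewrite mulr_ge0// sqr_ge0.
have -> : u ^+ 2 + c * v ^+ 2 = `|u| ^+ 2 * (1 + c * t ^+ 2).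
  by rewrite vE -normrX ger0_norm ?sqr_ge0//; ring.
have -> : `|u + v| = `|u| * (1 + t).
  have t0 : 0 <= 1 + t by lra.
  by rewrite -(ger0_norm t0) -normrM vE; congr (`| _ |); ring.
have -> : `|u - v| = `|u| * (1 - t).
  have t0 : 0 <= 1 - t by lra.
  by rewrite -(ger0_norm t0) -normrM vE; congr (`| _ |); ring.
rewrite !powRM ?sqr_ge0 ?normr_ge0//; try by lra.
have -> : `|u| `^ (p / 2) * `|u| `^ (p / 2) = `|u| `^ p.
  rewrite -powRD -?splitr//; apply/implyP => _; exact: u0'.
rewrite -mulrDr -mulrA.
apply: ler_wpM2l; first exact: powR_ge0.
apply: (le_trans (y := 1 + c * t ^+ 2)).
  by apply: ler1_powR; lra.
have r01 : 0 < p - 1 < 1 by apply/andP; split; lra.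
have b1 : 0 <= 1 + t <= 2 by apply/andP; split; lra.
have b2 : 0 <= 1 - t <= 2 by apply/andP; split; lra.
have := powR_ge_quadratic r01 b1; have := powR_ge_quadratic r01 b2.
rewrite (_ : 1 + (p - 1) = p) -/c; last by ring.
move: (_ `^ _) (_ `^ _) => X Y; lra.
Qed.

(** The right-hand side is symmetric in u and v, and exchanging them when u is the
    smaller one can only increase the left-hand side. *)
Lemma two_point p u v : 1 < p < 2 ->
  (u ^+ 2 + (p - 1) ^+ 2 / 2 * v ^+ 2) `^ (p / 2)
    <= (`|u + v| `^ p + `|u - v| `^ p) / 2.
Proof.
move=> p12; have [vu|/ltW uv] := leP `|v| `|u|; first exact: two_point_dominated.
move: (p12) => /andP[p1 p2].
apply: le_trans (le_trans (two_point_dominated p12 uv) _); last first.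
  by rewrite [v + u]addrC [`|v - u|]distrC.
have uv2 : u ^+ 2 <= v ^+ 2 by rewrite -[u ^+ 2]real_normK ?num_real// -[v ^+ 2]real_normK ?num_real// ler_sqr ?nnegrE.
have c1 : (p - 1) ^+ 2 / 2 <= 1 by nra.
have c0 : 0 <= (p - 1) ^+ 2 / 2 by rewrite divr_ge0// sqr_ge0.
apply: ler_powR_base; first by lra.
  by rewrite addr_ge0 ?sqr_ge0// mulr_ge0 ?sqr_ge0.
move: ((p - 1) ^+ 2 / 2) c1 c0 => c c1 c0; nra.
Qed.

Lemma powR_superadditive s a b : 1 <= s -> 0 <= a -> 0 <= b ->
  a `^ s + b `^ s <= (a + b) `^ s.
Proof.
move=> s1 a0 b0; have s0 : 0 < s by lra.
rewrite -!(mulr_powRB1 _ s0)//; last exact: addr_ge0.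
rewrite mulrDl; apply: lerD; apply: ler_wpM2l => //; apply: ler_powR_base; lra.
Qed.

(** Clarkson's inequality on the line: u ^ 2 + v ^ 2 is the mean of (u + v) ^ 2 and
    (u - v) ^ 2, and the power p / 2 is superadditive and convex. *)
Lemma clarkson_scalar p u v : 2 <= p ->
  `|u| `^ p + `|v| `^ p <= (`|u + v| `^ p + `|u - v| `^ p) / 2.
Proof.
move=> p2.
have E w : `|w| `^ p = (w ^+ 2) `^ (p / 2).
  by rewrite -[w ^+ 2]real_normK ?num_real// -powR_mulrn// -powRrM mulrCA mulfV// mulr1.
rewrite !E; apply: le_trans (powR_superadditive _ (sqr_ge0 _) (sqr_ge0 _)) _; first by lra.
rewrite (_ : u ^+ 2 + v ^+ 2 = 2^-1 * (u + v) ^+ 2 + (1 - 2^-1) * (u - v) ^+ 2); last by field.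
apply: le_trans (powR_convex _ _ _ (sqr_ge0 _) (sqr_ge0 _)) _; [lra|lra|lra|].
move: (_ `^ _) => X; move: (_ `^ _) => Y; lra.
Qed.

Variable d : nat.
Implicit Types (z w : 'rV[R]_d).

(** A reverse Minkowski inequality for the exponent p / 2 < 1: it is the triangle
    inequality for the norm of exponent 2 / p in the plane, applied to the sum of
    the vectors (|z_i| ^ p, c ^ (p / 2) |w_i| ^ p). *)
Lemma lp_sqr_sum_le p c z w : 1 < p < 2 -> 0 <= c ->
  (lp_norm p z ^+ 2 + c * lp_norm p w ^+ 2) `^ (p / 2)
    <= \sum_(i < d) (z 0 i ^+ 2 + c * w 0 i ^+ 2) `^ (p / 2).
Proof.
move=> /andP[p1 p2] c0; have p0 : 0 < p by lra.
have r1 : 1 <= 2 / p by rewrite ler_pdivlMr// mul1r ltW.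
have rV : (2 / p)^-1 = p / 2 by rewrite invf_div.
pose pr a b : 'rV[R]_2 := \row_j (if j == 0 then a else c `^ (p / 2) * b).
have prE a b : 0 <= a -> 0 <= b ->
    lp_norm (2 / p) (pr (a `^ p) (b `^ p)) = (a ^+ 2 + c * b ^+ 2) `^ (p / 2).
  move=> a0 b0; rewrite /lp_norm rV big_ord_recl big_ord1 !mxE/=.
  rewrite !ger0_norm ?mulr_ge0 ?powR_ge0// powRM ?powR_ge0// -!powRrM.
  rewrite (_ : p * (2 / p) = 2%:R); last by field; rewrite gt_eqF.
  rewrite (_ : p / 2 * (2 / p) = 1); last by field; rewrite gt_eqF.
  by rewrite !powR_mulrn// powRr1.
rewrite -prE ?lp_norm_ge0//.
rewrite (_ : pr _ _ = \sum_(i < d) pr (`|z 0 i| `^ p) (`|w 0 i| `^ p)).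
  apply: le_trans (ler_lp_norm_sum r1 _ _) _; apply: ler_sum => i _.
  by rewrite prE// !real_normK// num_real.
apply/rowP => j; rewrite summxE !mxE; case: ifP => j0.
  by rewrite lp_norm_powR ?(ltW p1)//; apply: eq_bigr => i _; rewrite mxE j0.
rewrite lp_norm_powR ?(ltW p1)// mulr_sumr; apply: eq_bigr => i _.
by rewrite mxE j0.
Qed.

(** The degree and a modulus of uniform convexity of the lp norm: its square is
    strongly convex for p < 2, its p-th power is uniformly convex for p >= 2. *)
Definition ucdeg p : R := Num.max p 2.
Definition ucmod p : R := if p < 2 then (p - 1) ^+ 2 / 8 else 2 `^ (- p).

Lemma ucdeg_ge2 p : 2 <= ucdeg p. Proof. by rewrite le_max lexx orbT. Qed.

Lemma ucdeg_le2 p : p <= 2 -> ucdeg p = 2.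
Proof. by move=> p2; rewrite /ucdeg max_r. Qed.

Lemma ucdeg_id p : 2 <= p -> ucdeg p = p.
Proof. by move=> p2; rewrite /ucdeg max_l. Qed.

Lemma ucmod_gt0 p : 1 < p -> 0 < ucmod p.
Proof.
move=> p1; rewrite /ucmod; case: ifP => _; last exact: powR_gt0.
by rewrite divr_gt0// exprn_gt0// subr_gt0.
Qed.

Lemma ucmod_le1 p : 1 < p -> ucmod p <= 1.
Proof.
move=> p1; rewrite /ucmod; case: ifP => p2; first by nra.
rewrite powRN invf_le1 ?powR_gt0// -{1}(powRr0 (2 : R)).
by apply: ler_powR; [lra | move: p1; lra].
Qed.

Lemma clarkson_lp p z w : 2 <= p ->
  lp_norm p z `^ p + lp_norm p w `^ p
    <= (lp_norm p (z + w) `^ p + lp_norm p (z - w) `^ p) / 2.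
Proof.
move=> p2; have p1 : 1 <= p by lra.
pose S (x : 'rV[R]_d) := \sum_(i < d) `|x 0 i| `^ p.
suff h : S z + S w <= (S (z + w) + S (z - w)) / 2.
  have key (A B C D a b c e : R) : A = a -> B = b -> C = c -> D = e ->
    a + b <= (c + e) / 2 -> A + B <= (C + D) / 2 by move=> -> -> -> ->.
  by exact: (key _ _ _ _ _ _ _ _ (lp_norm_powR p1 z) (lp_norm_powR p1 w)
    (lp_norm_powR p1 (z + w)) (lp_norm_powR p1 (z - w)) h).
rewrite /S -big_split -[in leRHS]big_split/= mulr_suml.
by apply: ler_sum => i _; rewrite !mxE; exact: clarkson_scalar.
Qed.

(** A weak form of the Ball-Carlen-Lieb inequality, obtained by summing the
    two-point inequality over the coordinates and passing from p-th powers to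
    squares by convexity of the power 2 / p. *)
Lemma strong_convexity_lp p z w : 1 < p < 2 ->
  lp_norm p z ^+ 2 + (p - 1) ^+ 2 / 2 * lp_norm p w ^+ 2
    <= (lp_norm p (z + w) ^+ 2 + lp_norm p (z - w) ^+ 2) / 2.
Proof.
move=> p12; move: (p12) => /andP[p1 p2].
have p1' := ltW p1; have p0 : 0 < p by lra.
have c0 : 0 <= (p - 1) ^+ 2 / 2 by rewrite divr_ge0// sqr_ge0.
have h1 := lp_sqr_sum_le z w p12 c0.
have h2 : \sum_(i < d) (z 0 i ^+ 2 + (p - 1) ^+ 2 / 2 * w 0 i ^+ 2) `^ (p / 2) <=
   2^-1 * lp_norm p (z + w) `^ p + (1 - 2^-1) * lp_norm p (z - w) `^ p.
  have -> : 1 - 2^-1 = 2^-1 :> R by field.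
  pose S (x : 'rV[R]_d) := \sum_(i < d) `|x 0 i| `^ p.
  have key (X A B a b : R) : A = a -> B = b ->
    X <= 2^-1 * a + 2^-1 * b -> X <= 2^-1 * A + 2^-1 * B by move=> -> ->.
  apply: (key _ _ _ (S (z + w)) (S (z - w))).
  - exact: (lp_norm_powR p1' (z + w)).
  - exact: (lp_norm_powR p1' (z - w)).
  rewrite /S -mulrDr -[in leRHS]big_split/= mulr_sumr.
  by apply: ler_sum => i _; rewrite [leRHS]mulrC !mxE; exact: two_point.
have r1 : 1 <= 2 / p by rewrite ler_pdivlMr// mul1r ltW.
have r0 : 0 <= 2 / p := le_trans ler01 r1.
have h3 := ler_powR_base r0 (powR_ge0 _ _) (le_trans h1 h2).
have h4 := powR_convex (t := 2^-1) r1 _ _ (powR_ge0 (lp_norm p (z + w)) p) (powR_ge0 (lp_norm p (z - w)) p).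
have {h1 h2 h3} h4 e1 e2 := le_trans h3 (h4 e1 e2).
have e1 : p / 2 * (2 / p) = 1 by field; rewrite gt_eqF.
have e2 : p * (2 / p) = 2%:R by field; rewrite gt_eqF.
move: h4 (lp_norm_ge0 p (z + w)) (lp_norm_ge0 p (z - w)).
move: (lp_norm p z) (lp_norm p w) (lp_norm p (z + w)) (lp_norm p (z - w)) => A B C D h4 C0 D0.
have X0 : 0 <= A ^+ 2 + (p - 1) ^+ 2 / 2 * B ^+ 2.
  by rewrite addr_ge0 ?sqr_ge0// mulr_ge0 ?sqr_ge0.
move: h4; rewrite -!powRrM e1 e2 powRr1// !powR_mulrn//.
by move=> h4; have := h4 ltac:(lra) ltac:(lra); lra.
Qed.

Lemma lp_norm_uniform_convex p z w : 1 < p ->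
  lp_norm p (2^-1 *: (z + w)) `^ ucdeg p <=
  (lp_norm p z `^ ucdeg p + lp_norm p w `^ ucdeg p) / 2
    - ucmod p * lp_norm p (z - w) `^ ucdeg p.
Proof.
move=> p1; have p1' := ltW p1; have p0 : 0 < p by lra.
have bE : lp_norm p (z - w) = 2 * lp_norm p (2^-1 *: (z - w)).
  by rewrite lp_normZ// gtr0_norm// mulVKf.
have zE : 2^-1 *: (z + w) + 2^-1 *: (z - w) = z by apply/rowP => i; rewrite !mxE; field.
have wE : 2^-1 *: (z + w) - 2^-1 *: (z - w) = w by apply/rowP => i; rewrite !mxE; field.
have N0 := lp_norm_ge0 p (2^-1 *: (z - w)).
rewrite bE {bE} /ucdeg /ucmod; case: ltP => p2; last first.
  have := clarkson_lp (2^-1 *: (z + w)) (2^-1 *: (z - w)) p2.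
  rewrite zE wE {zE wE}; move: N0; move: (lp_norm p _) (lp_norm p _) (lp_norm p _) (lp_norm p _).
  move=> B A Z W B0; rewrite powRM// mulrA -powRD ?addNr ?powRr0 ?mul1r; last exact/implyP.
  by move: (_ `^ _) (_ `^ _) (_ `^ _) (_ `^ _) => a b c e; lra.
have := @strong_convexity_lp p (2^-1 *: (z + w)) (2^-1 *: (z - w)).
rewrite zE wE p1 p2 => /(_ erefl) {zE wE N0}.
have key (A B C D : R) : 0 <= A -> 0 <= B -> 0 <= C -> 0 <= D ->
    A ^+ 2 + (p - 1) ^+ 2 / 2 * B ^+ 2 <= (C ^+ 2 + D ^+ 2) / 2 ->
    A `^ 2 <= (C `^ 2 + D `^ 2) / 2 - (p - 1) ^+ 2 / 8 * (2 * B) `^ 2.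
  by move=> *; rewrite !powR_mulrn ?mulr_ge0//; lra.
by apply: key; exact: lp_norm_ge0.
Qed.

End UniformConvexity.

(** * Abstract geometries *)

Definition cvx (R : realType) (V : lmodType R) (h : V -> R) : Prop :=
  forall t x y, 0 <= t -> t <= 1 ->
    h (t *: x + (1 - t) *: y) <= t * h x + (1 - t) * h y.

Definition uconvex (R : realType) (V : lmodType R) (nrm : V -> R) (m c : R)
    (h : V -> R) : Prop :=
  forall x y, h (2^-1 *: (x + y)) <= (h x + h y) / 2 - c * nrm (x - y) `^ m.

(** What the algorithm needs from lp: a norm with a dual norm and a pairing for
    which Hoelder's inequality is attained, uniform convexity of a power of the
    norm, and minimizers of uniformly convex functions.  The pairing is linear in
    its second argument, gradients being represented by vectors of V. *)
Record geometry (R : realType) (V : normedModType R) := Geometry {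
  nrm : V -> R;
  dnrm : V -> R;
  pair : V -> V -> R;
  dual_dir : V -> V;
  deg : R;
  ucm : R;
  nrm_ge0 : forall x, 0 <= nrm x;
  nrmD : forall x y, nrm (x + y) <= nrm x + nrm y;
  nrmZ : forall t x, nrm (t *: x) = `|t| * nrm x;
  nrm_continuous : continuous nrm;
  deg_ge2 : 2 <= deg;
  ucm_gt0 : 0 < ucm;
  ucm_le1 : ucm <= 1;
  nrm_uconvex : uconvex nrm deg ucm (fun x => nrm x `^ deg);
  pairDr : forall g x y, pair g (x + y) = pair g x + pair g y;
  pairZr : forall g t x, pair g (t *: x) = t * pair g x;
  pairBl : forall g g' x, pair (g - g') x = pair g x - pair g' x;
  pair_continuous : forall g, continuous (pair g);
  pair_le : forall g x, pair g x <= dnrm g * nrm x;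
  dual_dir_le1 : forall g, nrm (dual_dir g) <= 1;
  pair_dual_dir : forall g, pair g (dual_dir g) = dnrm g;
  argmin_exists : forall (c : R) (h : V -> R), 0 < c -> continuous h ->
    cvx h -> uconvex nrm deg c h -> exists v, forall z, h v <= h z
}.

Section ConvexFacts.
Variables (R : realType) (V : normedModType R) (G : geometry V).
Implicit Types (x y z c : V) (h : V -> R).
Local Notation N := (nrm G).
Local Notation m := (deg G).
Local Notation "g ⋅ x" := (pair G g x) (at level 40).

Lemma deg_gt0 : 0 < m. Proof. exact: lt_le_trans (deg_ge2 G). Qed.
Lemma deg_ge1 : 1 <= m. Proof. by apply: le_trans (deg_ge2 G); rewrite ler1n. Qed.

Lemma nrm0 : N 0 = 0.
Proof. by rewrite -(scale0r 0) nrmZ normr0 mul0r. Qed.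

Lemma nrmN x : N (- x) = N x.
Proof. by rewrite -scaleN1r nrmZ normrN1 mul1r. Qed.

Lemma nrmC x y : N (x - y) = N (y - x).
Proof. by rewrite -nrmN opprB. Qed.

Lemma nrm_dist z x y : N (x - y) <= N (x - z) + N (z - y).
Proof. by apply: le_trans (nrmD _ _ _); rewrite subrKA. Qed.

Lemma pairBr g x y : g ⋅ (x - y) = g ⋅ x - g ⋅ y.
Proof. by rewrite pairDr -scaleN1r pairZr mulN1r. Qed.

Lemma cvx_cst (a : R) : cvx (fun _ : V => a).
Proof. by move=> t x y _ _; rewrite -mulrDl subrKC mul1r. Qed.

Lemma cvxD h h' : cvx h -> cvx h' -> cvx (fun z => h z + h' z).
Proof.
move=> ch ch' t x y t0 t1; have := ch t x y t0 t1; have := ch' t x y t0 t1.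
rewrite !mulrDr addrACA => a b; exact: lerD.
Qed.

Lemma cvxZ (a : R) h : 0 <= a -> cvx h -> cvx (fun z => a * h z).
Proof.
move=> a0 ch t x y t0 t1; have := ler_wpM2l a0 (ch t x y t0 t1).
by rewrite mulrDr ![a * (_ * _)]mulrCA.
Qed.

Lemma cvx_affine (a : R) g y : cvx (fun z => a + g ⋅ (z - y)).
Proof.
move=> t x x' _ _ /=; rewrite !pairBr !pairDr !pairZr le_eqVlt; apply/orP; left.
by apply/eqP; ring.
Qed.

Lemma cvx_nrm_powR c : cvx (fun z => N (z - c) `^ m).
Proof.
move=> t x y t0 t1; have t1' : 0 <= 1 - t by rewrite subr_ge0.
have -> : t *: x + (1 - t) *: y - c = t *: (x - c) + (1 - t) *: (y - c).
  rewrite !scalerBr addrACA -opprD -scalerDl subrKC scale1r//.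
apply: le_trans (powR_convex deg_ge1 t0 t1 (nrm_ge0 _ _) (nrm_ge0 _ _)).
apply: ler_powR_base; [exact: ltW deg_gt0 | exact: nrm_ge0 |].
by apply: le_trans (nrmD _ _ _) _; rewrite !nrmZ !ger0_norm.
Qed.

Lemma uconvex_nrm_powR c : uconvex N m (ucm G) (fun z => N (z - c) `^ m).
Proof.
move=> x y /=; have -> : x - y = (x - c) - (y - c) by rewrite opprB addrA subrK.
have -> : 2^-1 *: (x + y) - c = 2^-1 *: ((x - c) + (y - c)).
  rewrite addrACA -opprD scalerBr; congr (_ - _).
  by rewrite -{1}[c]scale1r -[c + c]mulr2n -[c *+ 2]scaler_nat scalerA mulVf ?pnatr_eq0.
exact: nrm_uconvex.
Qed.

Lemma cvx_mid h x y : cvx h -> h (2^-1 *: (x + y)) <= (h x + h y) / 2.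
Proof.
move=> /(_ 2^-1 x y); have -> : 1 - 2^-1 = 2^-1 :> R by field.
rewrite -scalerDr -mulrDr mulrC => H; apply: H; first by rewrite invr_ge0.
by rewrite invf_le1 ?ler1n.
Qed.

Lemma uconvexDl (c : R) h h' : cvx h -> uconvex N m c h' ->
  uconvex N m c (fun z => h z + h' z).
Proof.
move=> ch uh x y; have := cvx_mid x y ch; have := uh x y => {ch uh}.
move: (h _) (h' _) (h _) (h' _) (h _) (h' _) (_ `^ _) => a1 a2 a3 a4 a5 a6 a7; lra.
Qed.

Lemma uconvexZ (a c : R) h : 0 <= a -> uconvex N m c h ->
  uconvex N m (a * c) (fun z => a * h z).
Proof.
move=> a0 uh x y; have := ler_wpM2l a0 (uh x y).
move: (h _) (h _) (h _) (_ `^ _) => a1 a2 a3 a4; lra.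
Qed.

(** Compare the minimum with the value at the midpoint of v and x. *)
Lemma uconvex_growth (c : R) h v : uconvex N m c h -> (forall z, h v <= h z) ->
  forall x, h v + 2 * c * N (x - v) `^ m <= h x.
Proof.
move=> uh vmin x; have := le_trans (vmin _) (uh x v).
move: (h _) (h _) (_ `^ _) => a1 a2 a3; lra.
Qed.

Lemma powR_continuous_gt0 (a : R) : 0 < a -> {for a, continuous ((@powR R)^~ m)}.
Proof.
move=> a0; apply: differentiable_continuous; apply/derivable1_diffP.
by apply: derivable_powR; rewrite in_itv/= a0.
Qed.

(** Away from zeros of the norm this is differentiability of the power; at a zero
    u ^ m <= u for u <= 1. *)
Lemma continuous_nrm_powR c : continuous (fun z => N (z - c) `^ m).
Proof.
move=> x; have cN : {for x, continuous (fun z => N (z - c))}.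
  apply: (@continuous_comp _ _ _ (fun z => z - c) N).
    by apply: cvgB; [exact: cvg_id | exact: cvg_cst].
  exact: nrm_continuous.
have [x0|x0] := eqVneq (N (x - c)) 0; last first.
  apply: (@continuous_comp _ _ _ (fun z => N (z - c)) ((@powR R)^~ m)) => //.
  by apply: powR_continuous_gt0; rewrite lt_neqAle eq_sym x0 nrm_ge0.
apply/(@cvgrPdist_le _ _ _ (nbhs x)) => e e0.
rewrite /= x0 powR0 ?gt_eqF ?deg_gt0//; near=> z.
have Nz : N (z - c) <= Num.min 1 e.
  have : `|N (x - c) - N (z - c)| <= Num.min 1 e.
    by near: z; apply: cvgr_dist_le => //; rewrite lt_min ltr01.
  by rewrite x0 sub0r normrN ger0_norm ?nrm_ge0.
rewrite sub0r normrN ger0_norm ?powR_ge0//.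
have [N0|N0] := eqVneq (N (z - c)) 0.
  by rewrite N0 powR0 ?gt_eqF ?deg_gt0// ltW.
have Ngt0 : 0 < N (z - c) by rewrite lt_neqAle eq_sym N0 nrm_ge0.
move: Nz; rewrite le_min => /andP[N1 Ne]; apply: le_trans Ne.
by apply: ge1r_powR; rewrite ?Ngt0 ?N1// deg_ge1.
Unshelve. all: by end_near. Qed.

(** The subproblems of the method involve no oracle call, so they are solved by
    choice. *)
Definition argmin_of h : V := xget 0 [set v | forall z, h v <= h z].

Lemma argmin_ofP (c : R) h : 0 < c -> continuous h -> cvx h ->
  uconvex N m c h -> forall z, h (argmin_of h) <= h z.
Proof.
move=> c0 hc hcvx hu; have [v vmin] := argmin_exists c0 hc hcvx hu.
exact: (@xgetPex _ 0 [set v | forall z, h v <= h z] (ex_intro _ v vmin)).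
Qed.

End ConvexFacts.

(** * The lp geometry *)

Section LpGeometry.
Variables (R : realType) (p : R) (d : nat).
Hypothesis p1 : 1 < p.
Local Notation N := (@lp_norm R p d).
Local Notation m := (ucdeg p).

Lemma dot_continuous (g : 'rV[R]_d) : continuous (dot g).
Proof.
rewrite /dot; elim: (index_enum _) => [|i s IH].
  by under eq_fun do rewrite big_nil; exact: cst_continuous.
under eq_fun do rewrite big_cons.
by move=> x; apply: cvgD (IH x); apply: cvgM; [exact: cvg_cst | exact: coord_continuous].
Qed.

Lemma lp_ball_compact (r : R) : compact [set x : 'rV[R]_d | N x <= r].
Proof.
apply: bounded_closed_compact.
  exists r; split; first exact: num_real.
  by move=> M rM x /= xr; apply: le_trans (mx_norm_le_lp_norm (ltW p1) x) (le_trans xr (ltW rM)).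
have := @closed_comp _ _ N [set t | t <= r] _ (@closed_le R r).
by apply => x _; exact: lp_norm_continuous (ltW p1) x.
Qed.

(** Uniform convexity makes h coercive: convexity along the ray through x bounds h
    from below by a linear function of the norm ([low]), and one application of
    uniform convexity at x / 2 improves this to a power of degree m >= 2 ([far]).
    A minimizer on a large ball is then a global one. *)
Lemma uconvex_argmin_exists (c : R) (h : 'rV[R]_d -> R) : 0 < c ->
  continuous h -> cvx h -> uconvex N m c h -> exists v, forall z, h v <= h z.
Proof.
move=> c0 hc hcvx hu; have p1' := ltW p1.
have min_ball r : 0 <= r -> exists v, forall z, N z <= r -> h v <= h z.
  move=> r0; have [||v _ vmin] := @compact_EVT_min 'rV[R]_d R h _ _ (@lp_ball_compact r).
  - by exists 0 => /=; rewrite lp_norm0.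
  - by apply: continuous_subspaceT.
  - by exists v => z zr; apply: vmin; rewrite inE.
have [b bmin] := min_ball 1 ler01.
pose M := h 0 - h b.
have M0 : 0 <= M by rewrite subr_ge0 bmin// lp_norm0.
have low x : 1 <= N x -> h 0 - N x * M <= h x.
  move=> x1; have x0 : 0 < N x by exact: lt_le_trans x1.
  have := hcvx (N x)^-1 x 0; rewrite invr_ge0 (ltW x0) invf_le1// x1 => /(_ erefl erefl).
  rewrite scaler0 addr0 => h1.
  have h2 : h b <= h ((N x)^-1 *: x).
    by apply: bmin; rewrite lp_normZ// normfV gtr0_norm// mulVf ?gt_eqF.
  have := le_trans h2 h1; rewrite -(ler_pM2l x0) mulrDr mulrA mulfV ?gt_eqF// mul1r.
  rewrite mulrA mulrBr mulfV ?gt_eqF// mulr1 /M.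
  move: (N x) (h b) (h x) (h 0) => a1 a2 a3 a4; nra.
have far x : 2 <= N x -> M / c <= N x -> h 0 <= h x.
  move=> x2 xM; have x1 : 1 <= N x by apply: le_trans x2; rewrite ler1n.
  have half : N (2^-1 *: x) = N x / 2 by rewrite lp_normZ// ger0_norm ?invr_ge0// mulrC.
  have h1 := hu x 0; have h2 := low (2^-1 *: x).
  move: h1 h2; rewrite addr0 subr0 half ler_pdivlMr// mul1r => h1 /(_ x2) h2.
  have h3 : N x ^+ 2 <= N x `^ m.
    by rewrite -powR_mulrn ?lp_norm_ge0//; apply: ler_powR => //; exact: ucdeg_ge2.
  have x0 : 0 <= N x by exact: lp_norm_ge0.
  have h4 : N x * M <= c * N x `^ m.
    apply: le_trans (ler_wpM2l (ltW c0) h3); rewrite expr2 mulrCA.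
    by apply: ler_wpM2l => //; rewrite mulrC -ler_pdivrMr.
  have key (a u X Y : R) : a <= (u + X) / 2 - Y -> X - Y <= a -> X <= u.
    by clear; lra.
  apply: (key _ _ _ _ h1).
  apply: le_trans h2; rewrite lerD2l lerN2; apply: le_trans h4.
  by apply: ler_wpM2r => //; rewrite ler_pdivrMr// ler_peMr// ler1n.
have r0 : 0 <= Num.max 2 (M / c) by rewrite le_max ler0n.
have [v vmin] := min_ball _ r0; exists v => z.
have [|/ltW] := leP (N z) (Num.max 2 (M / c)); first exact: vmin.
rewrite ge_max => /andP[z2 zM]; apply: le_trans (far z z2 zM).
by apply: vmin; rewrite lp_norm0.
Qed.

Let q := p / (p - 1).

Lemma conjugate_gt1 : 1 < q.
Proof. by rewrite /q ltr_pdivlMr ?subr_gt0// mul1r gtrBl. Qed.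

Lemma conjugate_sum : p^-1 + q^-1 = 1.
Proof.
by rewrite /q invf_div; field; rewrite gt_eqF// (lt_trans ltr01).
Qed.

Definition lp_geometry : geometry 'rV[R]_d :=
  @Geometry R _ N (@lp_norm R q d) (@dot R d) (@dual_direction R d q) m (ucmod p)
    (@lp_norm_ge0 R p d) (ler_lp_normD (ltW p1)) (lp_normZ (ltW p1))
    (lp_norm_continuous (ltW p1)) (ucdeg_ge2 p) (ucmod_gt0 p1) (ucmod_le1 p1)
    (fun x y => lp_norm_uniform_convex x y p1)
    (@dotDr R d) (@dotZr R d) (@dotBl R d) dot_continuous
    (dot_le_lp_norm p1 conjugate_gt1 conjugate_sum)
    (fun g => (dual_directionP p1 conjugate_gt1 conjugate_sum g).1)
    (fun g => (dual_directionP p1 conjugate_gt1 conjugate_sum g).2)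
    uconvex_argmin_exists.

End LpGeometry.

Lemma diff_dot (R : realType) (d : nat) (f : 'rV[R]_d -> R) (x v : 'rV[R]_d) :
  differentiable f x -> 'd f x v = dot (gradient f x) v.
Proof.
move=> df; rewrite {1}[v]row_sum_delta linear_sum; apply: eq_bigr => i _.
by rewrite linearZ mxE mulrC.
Qed.

(** The difference quotients (f (x + h (y - x)) - f x) / h are at most f y - f x
    for 0 < h <= 1, and tend to the directional derivative. *)
Lemma convex_gradient_le (R : realType) (d : nat) (f : 'rV[R]_d -> R) (x y : 'rV[R]_d) :
  differentiable f x -> convex_function [set: 'rV[R]_d] f ->
  f x + dot (gradient f x) (y - x) <= f y.
Proof.
move=> df cf; rewrite -lerBrDl -diff_dot// -deriveE//.
have dv := @diff_derivable _ _ _ _ _ (y - x) df.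
have quot : (fun h : R => h^-1 *: ((f \o shift x) (h *: (y - x)) - f x)) h @[h --> 0^'+]
    --> 'D_(y - x) f x.
  by apply: cvg_dnbhs_at_right.
rewrite -(cvg_lim _ quot)//; apply: limr_le; first by apply/cvg_ex; exists ('D_(y - x) f x).
near=> h.
have h0 : 0 < h by near: h; exact: nbhs_right_gt.
have h1 : h <= 1 by near: h; exact: nbhs_right_le.
have := cf (Itv01 (ltW h0) h1) y x; rewrite !inE => /(_ Logic.I Logic.I).
rewrite convRE/= => cfh.
have -> : h *: (y - x) + x = h *: y + (1 - h) *: x.
  by rewrite scalerBl scale1r scalerBr addrAC -addrA.
rewrite -[_ *: _]/(_ * _) ler_pdivrMl// lerBlDr; apply: le_trans cfh _.
by rewrite mulrBl mul1r mulrBr addrA addrAC.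
Unshelve. all: by end_near. Qed.

(** * Query programs *)

Section Programs.
Variables (E Ans : Type).

(** A terminating adaptive algorithm: a tree whose inner nodes are oracle calls
    branching on the answer. *)
Inductive prog (X : Type) : Type :=
  | Ret of X
  | Ask of E & (Ans -> prog X).
Arguments Ret {X} _.
Arguments Ask {X} _ _.

Fixpoint bind (X Y : Type) (t : prog X) (k : X -> prog Y) : prog Y :=
  match t with
  | Ret o => k o
  | Ask x c => Ask x (fun a => bind (c a) k)
  end.

Variable O : E -> Ans.

Fixpoint queries (X : Type) (t : prog X) : seq E :=
  match t with
  | Ret _ => [::]
  | Ask x c => x :: queries (c (O x))
  end.

Fixpoint outcome (X : Type) (t : prog X) : X :=
  match t with
  | Ret o => o
  | Ask x c => outcome (c (O x))
  end.

Lemma queries_bind (X Y : Type) (t : prog X) (k : X -> prog Y) :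
  queries (bind t k) = queries t ++ queries (k (outcome t)).
Proof. by elim: t => [//|x c IH] /=; rewrite IH. Qed.

Lemma outcome_bind (X Y : Type) (t : prog X) (k : X -> prog Y) :
  outcome (bind t k) = outcome (k (outcome t)).
Proof. by elim: t => [//|x c IH] /=; rewrite IH. Qed.

End Programs.
Arguments Ret {E Ans X} _.
Arguments Ask {E Ans X} _ _.

(** * Accelerated minimization with verifiable steps *)

Section Acceleration.
Variables (R : realType) (V : normedModType R) (G : geometry V).
Local Notation N := (nrm G).
Local Notation m := (deg G).
Local Notation kap := (ucm G).
Local Notation "g ⋅ x" := (pair G g x) (at level 40).
Implicit Types (x y z c v : V) (phi h : V -> R) (k n : nat).

(** The convex combination whose weights k / (k + 2) and 2 / (k + 2) are the ratios
    A_k / A_{k+1} and a_{k+1} / A_{k+1} for [weight]. *)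
Definition mix k x v : V :=
  (k%:R / k.+2%:R) *: x + (1 - k%:R / k.+2%:R) *: v.

(** The model phi gains the linear lower bound of f at y, plus h, with weight
    a_{k+1} = lam * (k + 1). *)
Definition add_cut (lam : R) h k phi y (r : R * V) : V -> R :=
  fun z => phi z + lam * k.+1%:R * (r.1 + r.2 ⋅ (z - y) + h z).

(** n further steps of the estimate-sequence method for f + h, with current point x
    and model phi; the outcome is [None] as soon as a step violates the Lipschitz
    bound M. *)
Fixpoint accel (M lam : R) h n k x phi : prog V (R * V) (option V) :=
  match n with
  | 0 => Ret (Some x)
  | n'.+1 =>
    let y := mix k x (argmin_of phi) in
    Ask y (fun r =>
      let phi' := add_cut lam h k phi y r in
      let x' := mix k x (argmin_of phi') in
      Ask x' (fun r' =>
        if dnrm G (r'.2 - r.2) <= M * N (x' - y) then accel M lam h n' k.+1 x' phi'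
        else Ret None))
  end.

Variables (f : V -> R) (grad : V -> V).
Hypothesis f_grad : forall x y, f x + grad x ⋅ (y - x) <= f y.
Let oracle x := (f x, grad x).

(** Convexity at x, read backwards, replaces the integral along the segment: only
    the two gradients at x and y enter, at the price of a constant 1 instead of
    1 / 2. *)
Lemma descent (M : R) x y : dnrm G (grad x - grad y) <= M * N (x - y) ->
  f x <= f y + grad y ⋅ (x - y) + M * N (x - y) ^+ 2.
Proof.
move=> Mxy; have h1 := f_grad x y.
have h2 := pair_le G (grad x - grad y) (x - y).
have h3 := ler_wpM2r (nrm_ge0 G (x - y)) Mxy.
have h4 : grad x ⋅ (y - x) = - (grad x ⋅ (x - y)).
  by rewrite !pairBr opprB.
move: h1 (le_trans h2 h3); rewrite h4 pairBl expr2 mulrA.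
move: (f x) (f y) (_ ⋅ _) (_ ⋅ _) (_ * _) => a1 a2 a3 a4 a5; lra.
Qed.

(** Trading a quadratic for an m-th power: below tau the error is at most
    tau ^ m, above tau the power dominates. *)
Lemma powR_young (tau t : R) : 0 < tau -> 0 <= t ->
  tau `^ (m - 2) * t ^+ 2 <= t `^ m + tau `^ m.
Proof.
move=> tau0 t0; have m2 : 0 <= m - 2 by rewrite subr_ge0 deg_ge2.
have split u : 0 <= u -> u `^ m = u `^ (m - 2) * u ^+ 2.
  move=> u0; rewrite -powR_mulrn// -powRD; first by rewrite subrK.
  by apply/implyP; rewrite subrK gt_eqF// deg_gt0.
rewrite (split t)// (split tau (ltW tau0)).
have [tt|/ltW tt] := leP t tau.
  apply: (le_trans (y := tau `^ (m - 2) * tau ^+ 2)); last by rewrite lerDr mulr_ge0 ?powR_ge0 ?sqr_ge0.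
  by apply: ler_wpM2l; rewrite ?powR_ge0// ler_sqr ?nnegrE// ltW.
apply: (le_trans (y := t `^ (m - 2) * t ^+ 2)); last by rewrite lerDl mulr_ge0 ?powR_ge0 ?sqr_ge0.
by apply: ler_wpM2r; rewrite ?sqr_ge0//; apply: ler_powR_base => //; exact: ltW.
Qed.

Variables (M tau : R) (h : V -> R) (c : V).
Hypotheses (M0 : 0 < M) (tau0 : 0 < tau) (hc : continuous h) (hcvx : cvx h).
Let lam := kap * tau `^ (m - 2) / M.
Local Notation F z := (f z + h z).

Definition weight k : R := lam * (k%:R * k.+1%:R / 2).

(** The estimate sequence: the minimum of the model bounds A_k (f + h) at the current
    point from above, up to the accumulated error, while the model itself stays
    below A_k (f + h) plus the proximal term. *)
Record accel_inv k x phi : Prop := AccelInv {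
  phi_continuous : continuous phi;
  phi_cvx : cvx phi;
  phi_uconvex : uconvex N m kap phi;
  phi_lower : weight k * F x <= phi (argmin_of phi) + 2 * kap * k%:R * tau `^ m;
  phi_upper : forall z, phi z <= weight k * F z + N (z - c) `^ m
}.

Lemma accel_inv0 : accel_inv 0 c (fun z => N (z - c) `^ m).
Proof.
split.
- exact: continuous_nrm_powR.
- exact: cvx_nrm_powR.
- exact: uconvex_nrm_powR.
- by rewrite /weight !mul0r !mulr0 !mul0r addr0 powR_ge0.
- by move=> z; rewrite /weight !mul0r !mulr0 !mul0r add0r.
Qed.

Let lam_gt0 : 0 < lam.
Proof. by rewrite /lam divr_gt0// mulr_gt0 ?ucm_gt0 ?powR_gt0. Qed.

(** The new model at its minimizer w is at least the old minimum, plus the uniform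
    convexity term in w - v, plus the new cut at w.  Adding the cut at x, both cuts
    combine to the cut at x', as x' is the matching mixture of x and w.  Since
    x' - y = (1 - s) (w - v), the quadratic error of [descent] at x' is absorbed by
    the uniform convexity term through [powR_young]. *)
Lemma accel_step k x phi : accel_inv k x phi ->
  let y := mix k x (argmin_of phi) in
  let phi' := add_cut lam h k phi y (oracle y) in
  let x' := mix k x (argmin_of phi') in
  dnrm G (grad x' - grad y) <= M * N (x' - y) ->
  accel_inv k.+1 x' phi'.
Proof.
case=> phi_c phi_v phi_u lo up y phi' x' chk.
have k1 : 0 < k.+1%:R :> R by rewrite ltr0n.
have k2 : 0 < k.+2%:R :> R by rewrite ltr0n.
have a0 : 0 < lam * k.+1%:R by exact: mulr_gt0.
have wS : weight k.+1 = weight k + lam * k.+1%:R.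
  by rewrite /weight -[k.+2%:R]natr1 -[k.+1%:R]natr1; field.
have cutE : phi' = fun z => (lam * k.+1%:R) * (f y + grad y ⋅ (z - y) + h z) + phi z.
  by apply/funext => z; rewrite /phi' /add_cut addrC.
have ccut : cvx (fun z => lam * k.+1%:R * (f y + grad y ⋅ (z - y) + h z)).
  by apply: cvxZ; [exact: ltW | apply: cvxD => //; exact: cvx_affine].
have c' : continuous phi'.
  move=> z; rewrite cutE; apply: cvgD (phi_c z); apply: cvgM; first exact: cvg_cst.
  apply: cvgD; last exact: hc.
  apply: cvgD; first exact: cvg_cst.
  apply: (@continuous_comp _ _ _ (fun z => z - y) (pair G (grad y))).
    by apply: cvgB; [exact: cvg_id | exact: cvg_cst].
  exact: pair_continuous.
have v' : cvx phi' by rewrite cutE; exact: cvxD.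
have u' : uconvex N m kap phi' by rewrite cutE; exact: uconvexDl.
split => // [|z]; last first.
  rewrite cutE wS; have := up z; have := ler_wpM2l (ltW a0) (f_grad y z).
  move: (lam * _) (f z) (f y) (_ ⋅ _) (h z) (phi z) (weight k) (_ `^ _) => *; lra.
set v := argmin_of phi in y phi' x' chk cutE ccut c' v' u' *.
set w := argmin_of phi' in x' chk *.
have grow := uconvex_growth phi_u (argmin_ofP (ucm_gt0 G) phi_c phi_v phi_u) w.
set s := k%:R / k.+2%:R : R.
have s0 : 0 <= s by rewrite divr_ge0.
have s1 : 1 - s = 2 / k.+2%:R.
  have kE : k%:R = k.+2%:R - 2 :> R by rewrite -[k.+2%:R]natr1 -[k.+1%:R]natr1; ring.
  by rewrite /s kE; field; rewrite gt_eqF.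
have s1_ge0 : 0 <= 1 - s by rewrite s1 divr_ge0.
have sle1 : s <= 1 by rewrite -subr_ge0.
have sA : weight k = s * weight k.+1.
  by rewrite /weight /s; field; rewrite gt_eqF.
have sa : lam * k.+1%:R = (1 - s) * weight k.+1.
  by rewrite s1 /weight; field; rewrite gt_eqF.
have A0 : 0 <= weight k.+1.
  by apply: mulr_ge0; [exact: ltW | rewrite divr_ge0// mulr_ge0].
have xyE : x' - y = (1 - s) *: (w - v).
  by rewrite /x' /y /mix -/s opprD addrACA subrr add0r scalerBr.
have aff : grad y ⋅ (x' - y) = s * (grad y ⋅ (x - y)) + (1 - s) * (grad y ⋅ (w - y)).
  rewrite /x' /mix -/s !pairBr pairDr !pairZr; ring.
have hx' := hcvx x w s0 sle1.
have des := descent chk.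
have young := powR_young tau0 (nrm_ge0 G (w - v)).
have kap0 : 0 <= 2 * kap by rewrite mulr_ge0// ltW// ucm_gt0.
(* lam is chosen so that this coefficient is (k + 1) / (k + 2) <= 1 times
   the one of powR_young *)
have quad : weight k.+1 * (M * N (x' - y) ^+ 2) <= 2 * kap * (N (w - v) `^ m + tau `^ m).
  rewrite xyE nrmZ ger0_norm// exprMn.
  apply: (le_trans (y := 2 * kap * (tau `^ (m - 2) * N (w - v) ^+ 2))); last first.
    exact: ler_wpM2l young.
  have -> : weight k.+1 * (M * ((1 - s) ^+ 2 * N (w - v) ^+ 2)) =
      k.+1%:R / k.+2%:R * (2 * kap * (tau `^ (m - 2) * N (w - v) ^+ 2)).
    by rewrite s1 /weight /lam; field; rewrite !gt_eqF.
  rewrite ler_piMl//; last by rewrite ler_pdivrMr// mul1r ler_nat.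
  by apply: mulr_ge0 => //; rewrite mulr_ge0 ?powR_ge0 ?sqr_ge0.
have fx := ler_wpM2l (mulr_ge0 s0 A0) (f_grad y x).
have des' := ler_wpM2l A0 des.
have hx'' := ler_wpM2l A0 hx'.
have phiw : phi' w = (lam * k.+1%:R) * (f y + grad y ⋅ (w - y) + h w) + phi w by rewrite cutE.
rewrite phiw sa; move: lo fx des' hx'' quad grow; rewrite sA aff -/(mix k x w) -/x' -(natr1 k) -/v.
move: (weight k.+1) (tau `^ m) (N (w - v) `^ m) (N (x' - y) ^+ 2) (f x') (h x') (f x) (f y)
  (h x) (h w) (phi v) (phi w) (_ ⋅ _) (_ ⋅ _) kap (s) (k%:R : R).
clear.
move=> A T W Q fx' hx' fx fy hx hw pv pw g1 g2 kp s kk *; lra.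
Qed.

Lemma accel_gap n x phi : accel_inv n x phi -> forall z,
  weight n * F x <= weight n * F z + N (z - c) `^ m + 2 * kap * n%:R * tau `^ m.
Proof.
move=> I z; apply: le_trans (phi_lower I) _; rewrite lerD2r.
apply: le_trans (phi_upper I z).
case: I => c1 c2 c3 _ _; exact: (argmin_ofP (ucm_gt0 G) c1 c2 c3).
Qed.

Lemma accelP n k x phi : accel_inv k x phi ->
  let t := accel M lam h n k x phi in
  (size (queries oracle t) <= 2 * n)%N /\
  match outcome oracle t with
  | Some x' => exists phi', accel_inv (k + n) x' phi'
  | None => exists x y, M * N (x - y) < dnrm G (grad x - grad y)
  end.
Proof.
elim: n k x phi => [|n IH] k x phi I /=.
  by split=> //; exists phi; rewrite addn0.
set y := mix k x (argmin_of phi); set x' := mix k x (argmin_of (add_cut _ _ _ _ _ _)).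
case: ifP => [chk|/negbT]; last first.
  by rewrite -ltNge mulnS; split=> //; exists x', y.
have [sz out] := IH _ _ _ (accel_step I chk).
by split; [rewrite mulnS !ltnS|rewrite -addSnnS].
Qed.

End Acceleration.

(** * Accumulative regularization: one run *)

(** With this factor the term added in stage s has slope at most
    eps / (6 * 2 ^ s) on the ball of [reg_slope]. *)
Definition slope_const (R : realType) (m : R) : R := (6 * 3 `^ m)^-1.

(** Chosen so that all constants cancel in [stage_precision]. *)
Definition iter_const (R : realType) (m k : R) : R :=
  3 * 4 `^ m / (k ^+ 2 * slope_const m).

(** The number of accelerated steps of stage s is [nsteps] of i - s, so that the
    stages become geometrically cheaper. *)
Definition nsteps (R : realType) (m k : R) (j : nat) : nat :=
  (Num.truncn ((iter_const m k * 2 ^+ j) `^ (m / (m + 2)))).+1.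
Arguments nsteps : simpl never.

Section Run.
Variables (R : realType) (V : normedModType R) (G : geometry V).
Local Notation N := (nrm G).
Local Notation m := (deg G).
Local Notation kap := (ucm G).
Local Notation "g ⋅ x" := (pair G g x) (at level 40).
Implicit Types (x y z c v : V) (h : V -> R) (k n s j : nat).

Local Notation slope_const := (slope_const m).
Local Notation iter_const := (iter_const m kap).
Local Notation nsteps := (nsteps m kap).

Variables (eps : R) (x0 : V) (M : R) (i : nat).

(** The bound on the distance from x_s to a minimizer of the current regularized
    objective; at s = 0 it is the guess for the distance from x0 to a minimizer
    of f. *)
Definition stage_radius s : R := 2 ^+ i * eps / M / 4 ^+ s.
Definition sigma s : R := slope_const * eps / 2 ^+ s / stage_radius s `^ (m - 1).
(** The threshold of [powR_young] for which n steps accumulate an error of the same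
    size as the proximal term, see [nsteps_tol]. *)
Definition tol s : R := stage_radius s * (nsteps (i - s))%:R `^ (- m^-1).

Fixpoint stages n s x h : prog V (R * V) (option V) :=
  match n with
  | 0 => Ret (Some x)
  | n'.+1 =>
    let h' := fun z => h z + sigma s * N (z - x) `^ m in
    bind (accel G M (kap * tol s `^ (m - 2) / M) h' (nsteps (i - s)) 0 x
            (fun z => N (z - x) `^ m))
      (fun o => match o with Some x' => stages n' s.+1 x' h' | None => Ret None end)
  end.

(** Both the point x and the trial point y are queried: if the gradients at x and y
    satisfy the Lipschitz bound M although the gradient at x is large, the guessed
    radius was too small. *)
Definition final_test (o : option V) : prog V (R * V) (V + bool) :=
  match o with
  | None => Ret (inr false)
  | Some x =>
    Ask x (fun r =>
      if dnrm G r.2 <= eps then Ret (inl x) else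
      let y := x - stage_radius i.+1 *: dual_dir G r.2 in
      Ask y (fun r' => Ret (inr (dnrm G (r'.2 - r.2) <= M * N (y - x)))))
  end.

(** The query of x0 only ensures that every run starts with a query, so that
    restarts can be chained without empty moves. *)
Definition run : prog V (R * V) (V + bool) :=
  Ask x0 (fun _ => bind (stages i.+1 0 x0 (fun _ => 0)) final_test).

Arguments stages : simpl never.

Lemma stagesS n s x h : stages n.+1 s x h =
  let h' := fun z => h z + sigma s * N (z - x) `^ m in
  bind (accel G M (kap * tol s `^ (m - 2) / M) h' (nsteps (i - s)) 0 x
          (fun z => N (z - x) `^ m))
    (fun o => match o with Some x' => stages n s.+1 x' h' | None => Ret None end).
Proof. by []. Qed.

Variables (f : V -> R) (grad : V -> V).
Hypothesis f_grad : forall x y, f x + grad x ⋅ (y - x) <= f y.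
Hypothesis f_cont : continuous f.
Hypotheses (eps0 : 0 < eps) (M0 : 0 < M).
Let oracle x := (f x, grad x).
Local Notation F h z := (f z + h z).

Lemma cvx_of_gradient : cvx f.
Proof.
move=> t x y t0 t1; set z := _ + _.
have h1 := f_grad z x; have h2 := f_grad z y.
have t1' : 0 <= 1 - t by rewrite subr_ge0.
have e : t * (grad z ⋅ (x - z)) + (1 - t) * (grad z ⋅ (y - z)) = 0.
  by rewrite !pairBr {2 4}/z pairDr !pairZr; ring.
have := ler_wpM2l t0 h1; have := ler_wpM2l t1' h2; move: e.
move: (_ ⋅ _) (_ ⋅ _) (f x) (f y) (f z) => a1 a2 a3 a4 a5; lra.
Qed.

Lemma stage_radius_gt0 s : 0 < stage_radius s.
Proof. by rewrite /stage_radius !divr_gt0 ?mulr_gt0 ?exprn_gt0. Qed.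

Lemma stage_radiusS s : stage_radius s.+1 = stage_radius s / 4.
Proof. by rewrite /stage_radius exprSr; field; rewrite !gt_eqF ?exprn_gt0. Qed.

Lemma slope_const_gt0 : 0 < slope_const.
Proof. by rewrite invr_gt0 mulr_gt0 ?powR_gt0. Qed.

Lemma sigma_gt0 s : 0 < sigma s.
Proof.
by rewrite /sigma !divr_gt0 ?mulr_gt0 ?exprn_gt0 ?powR_gt0 ?slope_const_gt0 ?stage_radius_gt0.
Qed.

Lemma sigma_radius s : sigma s * stage_radius s `^ m = slope_const * eps / 2 ^+ s * stage_radius s.
Proof.
have m0 := deg_gt0 G; have r0 := stage_radius_gt0 s.
rewrite /sigma -(mulr_powRB1 (ltW r0) m0); field.
by rewrite !gt_eqF ?exprn_gt0 ?powR_gt0.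
Qed.

Lemma nsteps_gt0 j : 0 < (nsteps j)%:R :> R. Proof. by rewrite ltr0n. Qed.

Lemma tol_gt0 s : 0 < tol s.
Proof. by rewrite mulr_gt0 ?powR_gt0 ?stage_radius_gt0 ?nsteps_gt0. Qed.

Lemma nsteps_tol s : (nsteps (i - s))%:R * tol s `^ m = stage_radius s `^ m.
Proof.
have m0 := deg_gt0 G; have n0 := nsteps_gt0 (i - s).
rewrite /tol powRM ?powR_ge0 ?(ltW (stage_radius_gt0 _))// -powRrM mulNr mulVf ?gt_eqF//.
by rewrite powR_inv1 ?ltW// mulrCA mulfV ?mulr1// gt_eqF.
Qed.

Lemma iter_const_gt0 : 0 < iter_const.
Proof.
by rewrite /iter_const divr_gt0 ?mulr_gt0 ?powR_gt0 ?exprn_gt0 ?ucm_gt0 ?slope_const_gt0.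
Qed.

Lemma nsteps_ge j : iter_const * 2 ^+ j <= (nsteps j)%:R `^ ((m + 2) / m).
Proof.
have m0 := deg_gt0 G; have m2 : 0 < m + 2 by rewrite addr_gt0.
have X0 : 0 <= iter_const * 2 ^+ j by rewrite mulr_ge0 ?exprn_ge0// ltW// iter_const_gt0.
have -> : iter_const * 2 ^+ j = ((iter_const * 2 ^+ j) `^ (m / (m + 2))) `^ ((m + 2) / m).
  by rewrite -powRrM mulf_div [m * _]mulrC mulfV ?powRr1// gt_eqF// mulr_gt0.
apply: ler_powR_base; [by rewrite divr_ge0// ltW| exact: powR_ge0|].
by apply: ltW; rewrite /nsteps; apply: Num.Theory.truncnS_gt.
Qed.

(** The accuracy 3 D ^ m / A_n reached by the accelerated method in stage s is at
    most the gap that forces the distance to the minimizer down to D / 4.  After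
    the powers of D cancel, this is the lower bound [nsteps_ge]. *)
Lemma stage_precision s : (s <= i)%N ->
  3 * stage_radius s `^ m <=
  kap * tol s `^ (m - 2) / M * ((nsteps (i - s))%:R * (nsteps (i - s)).+1%:R / 2)
    * (2 * kap * sigma s * stage_radius s.+1 `^ m).
Proof.
move=> si; have m0 := deg_gt0 G; have r0 := stage_radius_gt0 s; have n0 := nsteps_gt0 (i - s).
have k0 := ucm_gt0 G; have c0 := slope_const_gt0.
have m20 : 0 <= m - 2 by rewrite subr_ge0 deg_ge2.
have nge := nsteps_ge (i - s).
have tolE : tol s `^ (m - 2) = stage_radius s `^ (m - 2) * (nsteps (i - s))%:R `^ ((m + 2) / m) / (nsteps (i - s))%:R ^+ 2.
  rewrite /tol powRM ?powR_ge0 ?(ltW r0)// -powRrM -mulrA; congr (_ * _).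
  rewrite -powR_mulrn ?(ltW n0)// -powRB; last by apply/implyP => _; rewrite gt_eqF.
  by congr (_ `^ _); field; rewrite gt_eqF.
have r2 : stage_radius s `^ m = stage_radius s `^ (m - 2) * stage_radius s ^+ 2.
  rewrite -powR_mulrn ?(ltW r0)// -powRD; first by rewrite subrK.
  by apply/implyP; rewrite subrK gt_eqF.
have rS : stage_radius s.+1 `^ m = stage_radius s `^ m / 4 `^ m.
  by rewrite stage_radiusS powRM ?(ltW r0)// powRVl.
have D0 : 0 < stage_radius s `^ (m - 2) by exact: powR_gt0.
have F0 : 0 < 4 `^ m :> R by exact: powR_gt0.
have sg : sigma s * stage_radius s.+1 `^ m = slope_const * eps / 2 ^+ s * stage_radius s / 4 `^ m.
  by rewrite rS mulrA sigma_radius.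
have -> : 2 * kap * sigma s * stage_radius s.+1 `^ m = 2 * kap * (slope_const * eps / 2 ^+ s * stage_radius s / 4 `^ m).
  by rewrite -[_ * sigma s * _]mulrA sg.
rewrite tolE r2.
have E : kap * (stage_radius s `^ (m - 2) * (nsteps (i - s))%:R `^ ((m + 2) / m) / (nsteps (i - s))%:R ^+ 2) / M *
   ((nsteps (i - s))%:R * (nsteps (i - s)).+1%:R / 2) * (2 * kap * (slope_const * eps / 2 ^+ s * stage_radius s / 4 `^ m))
  = stage_radius s `^ (m - 2) * stage_radius s * (kap ^+ 2 * slope_const * eps / (M * 2 ^+ s * 4 `^ m)) *
    ((nsteps (i - s))%:R `^ ((m + 2) / m) * ((nsteps (i - s)).+1%:R / (nsteps (i - s))%:R)).
  by field; rewrite !gt_eqF ?exprn_gt0.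
rewrite E {E}.
have nn : (nsteps (i - s))%:R `^ ((m + 2) / m) <=
    (nsteps (i - s))%:R `^ ((m + 2) / m) * ((nsteps (i - s)).+1%:R / (nsteps (i - s))%:R).
  by rewrite ler_peMr ?powR_ge0// ler_pdivlMr// mul1r ler_nat.
have W0 : 0 <= stage_radius s `^ (m - 2) * stage_radius s * (kap ^+ 2 * slope_const * eps / (M * 2 ^+ s * 4 `^ m)).
  by apply: ltW; rewrite !(mulr_gt0, invr_gt0, exprn_gt0).
apply: le_trans (ler_wpM2l W0 (le_trans nge nn)).
rewrite le_eqVlt; apply/orP; left; apply/eqP.
have pw : 2 ^+ (i - s) = 2 ^+ i / 2 ^+ s :> R.
  by rewrite -[in RHS](subnK si) exprD mulfK// gt_eqF// exprn_gt0.
have rE : stage_radius s = 2 ^+ i * eps / M / (2 ^+ s * 2 ^+ s).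
  by rewrite /stage_radius -exprMn -natrM.
rewrite expr2 {2}rE pw /iter_const; field.
by rewrite !gt_eqF ?exprn_gt0.
Qed.

(** [reg_slope] bounds the growth of the regularizer near x; the bound holds on a
    ball large enough to contain all later points, so that it is inherited from
    stage to stage. *)
Record stage_inv s x h : Prop := StageInv {
  reg_continuous : continuous h;
  reg_cvx : cvx h;
  reg_argmin : exists z, (forall z', F h z <= F h z') /\ N (x - z) <= stage_radius s;
  reg_slope : forall y w t, N (y - x) <= 2 * stage_radius s -> N w <= 1 ->
    0 <= t -> t <= stage_radius s ->
    h (y + t *: w) <= h y + t * (eps / 3 * (1 - (2 ^+ s)^-1));
  reg_gap : (0 < s)%N -> forall z, F h x <= F h z + eps / 3 * stage_radius s
}.

Lemma stage_inv0 z : (forall z', f z <= f z') -> N (x0 - z) <= stage_radius 0 ->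
  stage_inv 0 x0 (fun _ => 0).
Proof.
move=> zmin zr; split => //.
- exact: cst_continuous.
- exact: cvx_cst.
- by exists z; split=> // z'; rewrite !addr0.
- by move=> y w t _ _ _ _; rewrite expr0 invr1 subrr !mulr0 addr0.
Qed.

Lemma slope_const_le : slope_const * 3 `^ m = 6^-1.
Proof. by rewrite /slope_const invfM mulfVK// gt_eqF// powR_gt0. Qed.

Lemma slope_const_le6 : slope_const <= 6^-1.
Proof.
rewrite -slope_const_le ler_peMr ?(ltW slope_const_gt0)//.
rewrite -{1}(powRr0 (3 : R)); apply: ler_powR; first by rewrite ler1n.
exact: ltW (deg_gt0 G).
Qed.

(** Convexity along the segment from y to y + T w, at whose far end the norm is at
    most 3 T. *)
Lemma nrm_powR_slope x y w T t : 0 < T -> 0 <= t -> t <= T ->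
  N (y - x) <= 2 * T -> N w <= 1 ->
  N (y + t *: w - x) `^ m <= N (y - x) `^ m + t / T * (3 * T) `^ m.
Proof.
move=> T0 t0 tT yx w1.
have tT0 : 0 <= t / T by rewrite divr_ge0// ltW.
have tT1 : t / T <= 1 by rewrite ler_pdivrMr// mul1r.
have := cvx_nrm_powR G x (y + T *: w) y tT0 tT1.
have -> : (t / T) *: (y + T *: w) + (1 - t / T) *: y = y + t *: w.
  rewrite scalerDr addrAC -scalerDl subrKC scale1r scalerA divfK// gt_eqF//.
move=> h1; apply: le_trans h1 _.
have h2 : N (y + T *: w - x) `^ m <= (3 * T) `^ m.
  apply: ler_powR_base; [exact: ltW (deg_gt0 G) | exact: nrm_ge0 |].
  rewrite addrAC; apply: le_trans (nrmD _ _ _) _; rewrite nrmZ gtr0_norm//.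
  have := ler_wpM2l (ltW T0) w1; move: (N _) (N _) yx => a b; lra.
have := ler_wpM2l tT0 h2.
have : 0 <= t / T * N (y - x) `^ m by rewrite mulr_ge0// powR_ge0.
move: (_ `^ _) (_ `^ _) (_ `^ _) (t / T) => a1 a2 a3 a4; lra.
Qed.

(** Adding a term centred at x cannot push the minimizer away from x: the old
    objective is no smaller at the new minimizer z' than at z, so the added term
    must be no larger there.  The accelerated method started at x then has
    initial distance at most D, and uniform convexity of the added term turns its
    function gap into the distance D / 4. *)
Lemma stage_step s x h n x' phi : (s <= i)%N -> stage_inv s x h ->
  let h' := fun z => h z + sigma s * N (z - x) `^ m in
  accel_inv G f M (tol s) h' x (nsteps (i - s)) x' phi ->
  stage_inv s.+1 x' h'.
Proof.
move=> si [hc hcv [z [zmin zx]] slope _] h' I.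
have m0 := deg_gt0 G; have s0 := sigma_gt0 s; have k0 := ucm_gt0 G.
have r0 := stage_radius_gt0 s; have r1 := stage_radius_gt0 s.+1.
have h'c : continuous h'.
  move=> u; apply: cvgD; first exact: hc.
  by apply: cvgM; [exact: cvg_cst | exact: continuous_nrm_powR].
have h'cv : cvx h' by apply: cvxD => //; apply: cvxZ (ltW s0) _; exact: cvx_nrm_powR.
have F'c : continuous (fun u => F h' u) by move=> u; apply: cvgD; [exact: f_cont|exact: h'c].
have F'cv : cvx (fun u => F h' u) by exact: cvxD cvx_of_gradient h'cv.
have F'u : uconvex N m (sigma s * kap) (fun u => F h' u).
  apply: uconvexDl cvx_of_gradient _; apply: uconvexDl hcv _.
  by apply: uconvexZ (ltW s0) _; exact: uconvex_nrm_powR.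
have [z' z'min] := argmin_exists (mulr_gt0 s0 k0) F'c F'cv F'u.
have z'x : N (x - z') <= stage_radius s.
  apply: le_trans zx; rewrite nrmC [N (x - z)]nrmC.
  rewrite leNgt; apply/negP => /(gt0_ltr_powR m0 (nrm_ge0 _ _) (nrm_ge0 _ _)).
  apply/negP; rewrite -leNgt -(ler_pM2l s0).
  have := z'min z; have := zmin z'; rewrite /h'.
  move: (f _) (h _) (f _) (h _) (sigma s * _) (sigma s * _) => *; lra.
have prec := stage_precision si.
have gap : F h' x' <= F h' z' + 2 * kap * sigma s * stage_radius s.+1 `^ m.
  have A0 : 0 < kap * tol s `^ (m - 2) / M * ((nsteps (i - s))%:R * (nsteps (i - s)).+1%:R / 2).
    by rewrite !(mulr_gt0, invr_gt0, powR_gt0, tol_gt0, ltr0n).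
  rewrite -(ler_pM2l A0) [leRHS]mulrDr; apply: le_trans (accel_gap I z') _.
  rewrite /weight -addrA lerD2l; apply: le_trans prec.
  rewrite -[_ * _ * _ * tol s `^ m]mulrA nsteps_tol.
  have h1 : N (z' - x) `^ m <= stage_radius s `^ m.
    by apply: ler_powR_base; rewrite ?nrm_ge0 ?(ltW m0)// nrmC.
  have h2 := ler_wpM2r (powR_ge0 (stage_radius s) m) (ucm_le1 G).
  by move: h1 h2; move: (_ `^ _) (_ `^ _) => *; lra.
have x'z' : N (x' - z') <= stage_radius s.+1.
  rewrite leNgt; apply/negP => /(gt0_ltr_powR m0 (ltW r1) (nrm_ge0 _ _)).
  apply/negP; rewrite -leNgt -(ler_pM2l (mulr_gt0 s0 k0)).
  have := le_trans (uconvex_growth F'u z'min x') gap.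
  by move: (f _) (h' _) (_ `^ _) (_ `^ _) (sigma s) (ucm G) => *; lra.
have x'x : N (x' - x) <= 5 / 4 * stage_radius s.
  apply: le_trans (nrm_dist _ z' _ _) _; rewrite [N (z' - x)]nrmC.
  by move: x'z' z'x; rewrite stage_radiusS; move: (N _) (N _) => *; lra.
split => //.
- by exists z'.
- move=> y w t yx' w1 t0 tr.
  have yx : N (y - x) <= 2 * stage_radius s.
    apply: le_trans (nrm_dist _ x' _ _) _.
    by move: yx' x'x; rewrite stage_radiusS; move: (N _) (N _) => *; lra.
  have tr' : t <= stage_radius s by apply: le_trans tr _; rewrite stage_radiusS; lra.
  have h1 := slope y w t yx w1 t0 tr'.
  have e : sigma s * (t / stage_radius s * (3 * stage_radius s) `^ m) = t * (eps / 6 / 2 ^+ s).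
    rewrite powRM ?(ltW r0)// mulrCA [_ * (3 `^ m * _)]mulrCA sigma_radius.
    have -> : 6^-1 = slope_const * 3 `^ m by rewrite slope_const_le.
    by field; rewrite !gt_eqF ?exprn_gt0.
  have h2 := ler_wpM2l (ltW s0) (nrm_powR_slope r0 t0 tr' yx w1).
  rewrite mulrDr e in h2.
  rewrite /h'; move: h1 h2; rewrite exprS invfM.
  move: (h _) (h _) (sigma s * _) (sigma s * _) ((2 ^+ s)^-1) => *; lra.
- move=> _ u; apply: le_trans gap _; apply: lerD; first exact: z'min.
  have e16 : 4 ^+ 2 <= 4 `^ m :> R.
    by rewrite -powR_mulrn//; apply: ler_powR; rewrite ?ler1n// deg_ge2.
  have p0 : 0 < 4 `^ m :> R by exact: powR_gt0.
  have p2 : 0 < 2 ^+ s :> R by exact: exprn_gt0.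
  have h1 : sigma s * stage_radius s.+1 `^ m <= eps / 6 * stage_radius s / 16.
    rewrite stage_radiusS powRM ?(ltW r0)// powRVl// mulrA sigma_radius.
    rewrite ler_pdivrMr//; apply: (le_trans (y := eps / 6 * stage_radius s)); last first.
      have q1 : 1 <= 16^-1 * 4 `^ m :> R.
        by rewrite mulrC ler_pdivlMr// mul1r; apply: le_trans e16; rewrite -natrX ler_nat.
      have q0 : 0 <= eps / 6 * stage_radius s by rewrite mulr_ge0 ?(ltW r0)// divr_ge0// ltW.
      by rewrite -[leRHS]mulrA; have := ler_wpM2l q0 q1; rewrite mulr1.
    apply: ler_wpM2r; first exact: ltW.
    rewrite ler_pdivrMr//; apply: (le_trans (y := eps / 6)).
      by rewrite [eps / 6]mulrC; apply: ler_wpM2r slope_const_le6; exact: ltW.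
    by rewrite ler_peMr ?divr_ge0 ?(ltW eps0)// exprn_ege1// ler1n.
  have h2 : kap * (sigma s * stage_radius s.+1 `^ m) <= sigma s * stage_radius s.+1 `^ m.
    by rewrite ler_piMl ?ucm_le1// mulr_ge0 ?powR_ge0// ltW.
  have e0 := mulr_gt0 eps0 r0.
  rewrite -[2 * kap * sigma s * _]mulrA -[2 * kap * _]mulrA.
  move: h1 h2; move: (sigma s * _) => X h1 h2; rewrite stage_radiusS.
  by move: (stage_radius s) (ucm G * X) e0 h1 h2 => *; lra.
Qed.

Definition run_cost : nat := (3 + \sum_(s < i.+1) 2 * nsteps (i - s))%N.

Lemma stagesP n s x h : (s + n = i.+1)%N -> continuous h -> cvx h ->
  let t := stages n s x h in
  (size (queries oracle t) <= \sum_(s <= j < i.+1) 2 * nsteps (i - j))%N /\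
  match outcome oracle t with
  | Some x' => stage_inv s x h -> exists h', stage_inv i.+1 x' h'
  | None => exists y z, M * N (y - z) < dnrm G (grad y - grad z)
  end.
Proof.
elim: n s x h => [|n IH] s x h sn hc hcv.
  by rewrite /stages /=; split=> // I; exists h; rewrite -sn addn0.
have si : (s <= i)%N by rewrite -ltnS -sn addnS ltnS leq_addr.
rewrite stagesS; set h' := fun z => _.
have h'c : continuous h'.
  move=> u; apply: cvgD; first exact: hc.
  by apply: cvgM; [exact: cvg_cst | exact: continuous_nrm_powR].
have h'cv : cvx h'.
  by apply: cvxD => //; apply: cvxZ (ltW (sigma_gt0 s)) _; exact: cvx_nrm_powR.
have [sz out] := accelP f_grad M0 (tol_gt0 s) h'c h'cv (nsteps (i - s))
  (accel_inv0 G f M (tol s) h' x).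
lazy zeta; rewrite queries_bind outcome_bind size_cat big_ltn; last by rewrite ltnS.
move: sz out; lazy zeta; rewrite -/oracle add0n; set t := accel _ _ _ _ _ _ _ _.
case: (outcome oracle t) => [x'|] sz out; last first.
  by split=> //; rewrite addn0; apply: leq_trans sz _; exact: leq_addr.
have sn' : (s.+1 + n = i.+1)%N by rewrite -sn addnS.
have [sz' out'] := IH s.+1 x' h' sn' h'c h'cv.
split; first exact: leq_add.
move: out'; case: (outcome _ _) => // y out' I; apply: out'.
by have [phi I'] := out; exact: stage_step si I I'.
Qed.

(** If a minimizer lies within the guessed radius, then f + h at x is minimal up to
    eps / 3 times the step t.  Along the trial step, f decreases by t times the
    dual norm of the gradient, up to M t ^ 2 <= t * eps / 4, and h increases by at
    most t * eps / 3; so the gradient would have norm below eps. *)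
Lemma runP :
  (size (queries oracle run) <= run_cost)%N /\
  match outcome oracle run with
  | inl x => x \in queries oracle run /\ dnrm G (grad x) <= eps
  | inr false => exists y z, M * N (y - z) < dnrm G (grad y - grad z)
  | inr true => forall z, (forall z', f z <= f z') -> stage_radius 0 < N (x0 - z)
  end.
Proof.
have -> : outcome oracle run =
  outcome oracle (bind (stages i.+1 0 x0 (fun _ => 0)) final_test) by [].
have -> : queries oracle run =
  x0 :: queries oracle (bind (stages i.+1 0 x0 (fun _ => 0)) final_test) by [].
rewrite outcome_bind queries_bind.
have [sz out] := stagesP x0 (add0n i.+1) (@cst_continuous _ _ 0) (cvx_cst 0).
move: sz out; lazy zeta; move: (stages i.+1 0 x0 (fun _ => 0)) => t sz out.
have {}sz : (size (queries oracle t) <= \sum_(s < i.+1) 2 * nsteps (i - s))%N.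
  by move: sz; rewrite big_mkord.
rewrite /run_cost [size _]/= size_cat.
case: (outcome oracle t) out => [x|] out /=; last first.
  by split => //; rewrite addn0 addnC addn3 !ltnS (leq_trans sz)// ltnW.
case: ifP => [gx|/negbT] /=.
  split; first by rewrite addn1 addnC addn3 !ltnS (leq_trans sz).
  by split => //; rewrite inE mem_cat mem_seq1 eqxx !orbT.
rewrite -ltNge => gx; split; first by rewrite addn2 addnC addn3 !ltnS.
set y := x - _; case: ifP => [chk|/negbT]; last by rewrite -ltNge; exists y, x.
move=> z zmin; rewrite ltNge; apply/negP => zr.
have [h [_ _ _ slope gap]] := out (stage_inv0 zmin zr).
have r0 := stage_radius_gt0 i.+1.
have yE : y = x + stage_radius i.+1 *: (- dual_dir G (grad x)) by rewrite scalerN.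
have h1 : h y <= h x + stage_radius i.+1 * (eps / 3 * (1 - (2 ^+ i.+1)^-1)).
  rewrite yE; apply: slope; [|by rewrite nrmN dual_dir_le1|exact: ltW|exact: lexx].
  by rewrite subrr nrm0 mulr_ge0// ltW.
have h2 := gap (ltn0Sn i) y.
have h3 := descent f_grad chk.
have yx : y - x = stage_radius i.+1 *: (- dual_dir G (grad x)) by rewrite yE addrAC subrr add0r.
have gy : grad x ⋅ (y - x) = - (stage_radius i.+1 * dnrm G (grad x)).
  by rewrite yx -scaleN1r !pairZr pair_dual_dir mulN1r mulrN.
have ny : M * N (y - x) ^+ 2 <= M * stage_radius i.+1 ^+ 2.
  apply: ler_wpM2l; first exact: ltW.
  rewrite ler_sqr ?nnegrE ?nrm_ge0 ?(ltW r0)// yx nrmZ nrmN gtr0_norm//.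
  by rewrite ler_piMr ?(ltW r0)// dual_dir_le1.
have Mr : M * stage_radius i.+1 <= eps / 4.
  have p2 : 0 < 2 ^+ i :> R by exact: exprn_gt0.
  have -> : M * stage_radius i.+1 = eps / 4 / 2 ^+ i.
    have e4 : 4 ^+ i.+1 = 4 * (2 ^+ i * 2 ^+ i) :> R by rewrite exprS -exprMn -natrM.
    by rewrite /stage_radius e4; field; rewrite !gt_eqF.
  by rewrite ler_pdivrMr// ler_peMr ?divr_ge0 ?(ltW eps0)// exprn_ege1// ler1n.
have B : stage_radius i.+1 * (eps / 3 * (1 - (2 ^+ i.+1)^-1)) <= stage_radius i.+1 * (eps / 3).
  apply: ler_wpM2l; first exact: ltW.
  by rewrite ler_piMr ?divr_ge0 ?(ltW eps0)// gerBl invr_ge0 exprn_ge0.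
have Mr2 : M * stage_radius i.+1 ^+ 2 <= stage_radius i.+1 * (eps / 4).
  by rewrite expr2 mulrA mulrC; apply: ler_wpM2l => //; exact: ltW.
have rg : stage_radius i.+1 * eps < stage_radius i.+1 * dnrm G (grad x) by rewrite ltr_pM2l.
have re := mulr_gt0 r0 eps0.
move: h1 h2 h3 ny B Mr2 rg re; rewrite gy.
move: (N _) ((2 ^+ i.+1)^-1) (stage_radius _).
move: (h _) (h _) (f _) (f _) (dnrm _ _); clear.
by move=> *; lra.
Qed.

End Run.

(** * Cost of a run *)

Section Cost.
Variables (R : realType) (m k : R).
Hypotheses (m2 : 2 <= m) (k0 : 0 < k) (k1 : k <= 1).

(** The ratio of the bounds in [run_cost_le] for consecutive i. *)
Definition growth : R := 2 `^ (m / (m + 2)).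
Definition run_const : R := 19 * iter_const m k `^ (m / (m + 2)).

Let a := m / (m + 2).

Lemma rate_ge_half : 2^-1 <= a.
Proof. by have h := m2; rewrite /a ler_pdivlMr; lra. Qed.

Lemma rate_le1 : a <= 1.
Proof. by have h := m2; rewrite /a ler_pdivrMr; lra. Qed.

Lemma growth_ge : 4 / 3 <= growth.
Proof.
have h : 2 `^ 2^-1 <= growth by apply: ler_powR; [by rewrite ler1n | exact: rate_ge_half].
apply: le_trans h; rewrite powR12_sqrt//.
have e : (4 / 3) ^+ 2 <= 2 :> R by lra.
rewrite -[leLHS]ger0_norm; last by lra.
by rewrite -sqrtr_sqr ler_wsqrtr.
Qed.

Lemma growthX i : (2 ^+ i) `^ a = growth ^+ i.
Proof. by rewrite -(powR_mulrn i (ler0n _ 2)) powRAC powR_mulrn// powR_ge0. Qed.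

Lemma iter_const_ge1 : 1 <= iter_const m k.
Proof.
have m0 : 0 < m by apply: lt_le_trans m2; rewrite ltr0n.
rewrite /iter_const ler_pdivlMr ?mul1r; last first.
  by rewrite mulr_gt0 ?exprn_gt0// invr_gt0 mulr_gt0 ?powR_gt0.
have p3 : 1 <= 3 `^ m :> R.
  by rewrite -{1}(powRr0 (3 : R)); apply: ler_powR; [by rewrite ler1n|exact: ltW].
have p4 : 1 <= 4 `^ m :> R.
  by rewrite -{1}(powRr0 (4 : R)); apply: ler_powR; [by rewrite ler1n|exact: ltW].
have s1 : slope_const m <= 1.
  by rewrite /slope_const invf_le1; lra.
have s0 : 0 <= slope_const m by rewrite /slope_const invr_ge0; lra.
have kk : k ^+ 2 <= 1 by rewrite expr_le1// ltW.
apply: (le_trans (y := 1)); last by lra.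
by rewrite mulr_ile1// sqr_ge0.
Qed.

Lemma growth_ge1 i : 1 <= growth ^+ i.
Proof. by rewrite exprn_ege1//; have := growth_ge; lra. Qed.

Lemma iter_const_powR_ge1 : 1 <= iter_const m k `^ a.
Proof.
rewrite -[leLHS](powRr0 (iter_const m k)); apply: ler_powR; first exact: iter_const_ge1.
by have := rate_ge_half; lra.
Qed.

Lemma nsteps_le j : (nsteps m k j)%:R <= 2 * iter_const m k `^ a * growth ^+ j.
Proof.
have C1 := iter_const_ge1; have C0 : 0 <= iter_const m k by lra.
rewrite /nsteps -/a powRM ?exprn_ge0// growthX -natr1.
have X0 : 0 <= iter_const m k `^ a * growth ^+ j.
  by rewrite mulr_ge0 ?powR_ge0// exprn_ge0// powR_ge0.
have X1 : 1 <= iter_const m k `^ a * growth ^+ j.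
  by rewrite mulr_ege1 ?growth_ge1// iter_const_powR_ge1.
have /andP[tr _] := truncn_itv X0.
by rewrite -mulrA [leRHS]mulr_natl mulr2n lerD.
Qed.

(** The factor 4 works because the ratio of the series is at least 4 / 3. *)
Lemma growth_sum i : \sum_(j < i.+1) growth ^+ j <= 4 * growth ^+ i.
Proof.
elim: i => [|i IH]; first by rewrite big_ord1 expr0; lra.
rewrite big_ord_recr /=; apply: le_trans (lerD IH (lexx _)) _.
have := growth_ge; have : 0 <= growth ^+ i by rewrite exprn_ge0// powR_ge0.
rewrite exprS; move: (growth ^+ i) growth => *; nra.
Qed.

Lemma run_cost_le i :
  (3 + \sum_(s < i.+1) 2 * nsteps m k (i - s))%:R <= run_const * growth ^+ i.
Proof.
rewrite natrD natr_sum (reindex_inj rev_ord_inj) /=.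
have h : \sum_(s < i.+1) (2 * nsteps m k (i - (i.+1 - s.+1)))%:R
    <= 4 * iter_const m k `^ a * \sum_(s < i.+1) growth ^+ s.
  rewrite mulr_sumr; apply: ler_sum => s _.
  have -> : (i - (i.+1 - s.+1))%N = s by rewrite subSS subKn// -ltnS.
  rewrite natrM; have := nsteps_le s.
  move: (_%:R) (_ `^ _) (growth ^+ s) => *; lra.
apply: le_trans (lerD (lexx _) h) _.
have C1 := iter_const_powR_ge1; have B1 := growth_ge1 i.
have C0 : 0 <= 4 * iter_const m k `^ a by lra.
apply: le_trans (lerD (lexx _) (ler_wpM2l C0 (growth_sum i))) _.
rewrite /run_const -/a; move: (_ `^ _) (growth ^+ i) C1 B1 => C B *; nra.
Qed.

End Cost.

(** * Chaining runs into a protocol *)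

Section Restarts.
Variables (E Ans J : Type) (runs : J -> prog E Ans (E + bool)) (next : J -> bool -> J).

(** When a run ends unsuccessfully, the next one starts at once, so that a state
    reached by answers is always waiting for an answer or finished. *)
Definition settle (js : J) (t : prog E Ans (E + bool)) : J * prog E Ans (E + bool) :=
  match t with
  | Ret (inr b) => (next js b, runs (next js b))
  | _ => (js, t)
  end.

Definition feed (st : J * prog E Ans (E + bool)) (a : Ans) :=
  match st.2 with
  | Ask _ c => settle st.1 (c a)
  | Ret _ => st
  end.

Variable O : E -> Ans.
Implicit Types (qs : seq E) (x : E) (st : J * prog E Ans (E + bool)).

Definition asks (t : prog E Ans (E + bool)) x : Prop := exists c, t = Ask x c.

(** The machine started in st and fed with the answers to qs asks exactly the
    points qs; the point e is the default value of [nth]. *)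
Definition follows e st qs : Prop := forall i, (i < size qs)%N ->
  asks (foldl feed st (map O (take i qs))).2 (nth e qs i).

Definition halts e st qs x : Prop :=
  follows e st qs /\ (foldl feed st (map O qs)).2 = Ret (inl x).

Lemma follows_prog e js t :
  follows e (settle js t) (queries O t) /\
  foldl feed (settle js t) (map O (queries O t)) = settle js (Ret (outcome O t)).
Proof.
elim: t => [y|x c IH]; first by split.
have [f1 f2] := IH (O x); split => [[|i]|] /=.
- by move=> _; exists c.
- by rewrite ltnS => /f1.
- exact: f2.
Qed.

Hypothesis runs_ask : forall js, exists x, asks (runs js) x.

Lemma settle_runs js : settle js (runs js) = (js, runs js).
Proof. by have [x [c ->]] := runs_ask js. Qed.

Lemma halts_found e js x : outcome O (runs js) = inl x ->
  halts e (js, runs js) (queries O (runs js)) x.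
Proof.
have [f1 f2] := follows_prog e js (runs js); rewrite settle_runs in f1 f2.
by move=> ox; split=> //; rewrite f2 ox.
Qed.

Lemma halts_restart e js b qs x : outcome O (runs js) = inr b ->
  halts e (next js b, runs (next js b)) qs x ->
  halts e (js, runs js) (queries O (runs js) ++ qs) x.
Proof.
have [f1 f2] := follows_prog e js (runs js); rewrite settle_runs in f1 f2.
move=> ob [g1 g2]; rewrite ob /= in f2.
split; last by rewrite map_cat foldl_cat f2.
move=> i; rewrite size_cat take_cat nth_cat; case: (ltnP i (size (queries O (runs js)))) => [iq _|qi iq].
  exact: f1.
by rewrite map_cat foldl_cat f2; apply: g1; rewrite ltn_subLR.
Qed.

End Restarts.

(** * The search for the smoothness constant and the radius *)

Section Outer.
Variables (R : realType) (V : normedModType R) (G : geometry V).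
Local Notation N := (nrm G).
Local Notation m := (deg G).
Local Notation kap := (ucm G).
Local Notation "g ⋅ x" := (pair G g x) (at level 40).
Implicit Types (x y z : V) (i j : nat).

Variables (eps : R) (x0 : V) (M0 : R).

Definition outer_run (ji : nat * nat) : prog V (R * V) (V + bool) :=
  run G eps x0 (M0 * 2 ^+ ji.1) ji.2.

(** While no radius has been refuted, i stays 0.  Afterwards, doubling M while
    incrementing i keeps the radius 2 ^ i * eps / M, which is known to be at most
    twice the true distance. *)
Definition outer_next (ji : nat * nat) (passed : bool) : nat * nat :=
  if passed then (ji.1, ji.2.+1) else (ji.1.+1, if ji.2 is 0 then 0 else ji.2.+1).

Variables (f : V -> R) (grad : V -> V) (L : R).
Hypothesis f_grad : forall x y, f x + grad x ⋅ (y - x) <= f y.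
Hypothesis f_cont : continuous f.
Hypothesis f_smooth : forall x y, dnrm G (grad x - grad y) <= L * N (x - y).
Hypotheses (eps0 : 0 < eps) (M0_gt0 : 0 < M0).
Let oracle x := (f x, grad x).

(** The second clause says that half of the current radius has been refuted. *)
Definition outer_inv (ji : nat * nat) : Prop :=
  M0 * 2 ^+ ji.1 <= 2 * L /\
  ((0 < ji.2)%N -> forall z, (forall z', f z <= f z') ->
    2 ^+ ji.2 * eps <= 2 * (M0 * 2 ^+ ji.1) * N (x0 - z)).

Lemma outer_step ji b : outer_inv ji -> outcome oracle (outer_run ji) = inr b ->
  outer_inv (outer_next ji b).
Proof.
case: ji => j i [/= Mj Ri] ob.
have Mj0 : 0 < M0 * 2 ^+ j by rewrite mulr_gt0 ?exprn_gt0.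
have [_] := runP x0 i f_grad f_cont eps0 Mj0.
rewrite -/oracle /outer_run /= in ob *; rewrite ob; case: b {ob} => [far|[y [z yz]]].
  split=> // _ z zmin; have := far z zmin.
  rewrite /stage_radius expr0 divr1 ltr_pdivrMr// => /ltW h.
  by rewrite exprS -!mulrA ler_pM2l// [leRHS]mulrA [leRHS]mulrC.
have ML : M0 * 2 ^+ j < L.
  rewrite ltNge; apply/negP => LM; move: yz; apply/negP; rewrite -leNgt.
  by apply: le_trans (f_smooth _ _) _; exact: ler_wpM2r (nrm_ge0 _ _) _ _ LM.
split => /=; first by rewrite exprS mulrCA ler_pM2l// ltW.
case: i Ri => // i Ri _ u umin; have := Ri (ltn0Sn i) u umin.
rewrite (exprS _ i.+1) (exprS _ j) => h.
have -> : 2 * (M0 * (2 * 2 ^+ j)) * N (x0 - u) = 2 * (2 * (M0 * 2 ^+ j) * N (x0 - u)) by ring.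
by rewrite -[leLHS]mulrA ler_pM2l.
Qed.

Lemma outer_run_ask ji : exists x, asks (outer_run ji) x.
Proof. by exists x0, (fun _ => bind (stages G eps (M0 * 2 ^+ ji.1) ji.2 ji.2.+1 0 x0 (fun _ => 0))
  (final_test G eps (M0 * 2 ^+ ji.1) ji.2)). Qed.

Local Notation B := (growth m).
Local Notation W := (run_const m kap).

Lemma outer_run_cost j i :
  (size (queries oracle (outer_run (j, i))))%:R <= W * B ^+ i.
Proof.
have Mj0 : 0 < M0 * 2 ^+ j by rewrite mulr_gt0 ?exprn_gt0.
have [sz _] := runP x0 i f_grad f_cont eps0 Mj0.
apply: le_trans (run_cost_le (deg_ge2 G) (ucm_gt0 G) (ucm_le1 G) i).
by rewrite ler_nat; exact: sz.
Qed.

Lemma run_const_ge0 : 0 <= W.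
Proof. by rewrite mulr_ge0 ?powR_ge0. Qed.

(** A bound on the number of calls made before the run (j, i) starts: each doubling
    of M may have cost one run at i = 0, and each smaller i at most one run. *)
Definition spent j i : R := W * (j%:R + \sum_(l < i) B ^+ l).

Lemma spent_next j i b :
  let ji := outer_next (j, i) b in spent j i + W * B ^+ i <= spent ji.1 ji.2.
Proof.
rewrite /spent -mulrDr; case: b => /=.
  by rewrite big_ord_recr /= addrA.
apply: ler_wpM2l; first exact: run_const_ge0.
case: i => [|i]; first by rewrite !big_ord0 expr0 !addr0 natr1.
rewrite [in leRHS]big_ord_recr /= addrA lerD2r lerD2r ler_nat; exact: leqnSn.
Qed.

(** Every restart increases j + i, which the invariant bounds. *)
Lemma outer_halts e (T : nat) :
  (forall j i, outer_inv (j, i) -> (j + i <= T)%N) ->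
  forall n j i, (T < n + (j + i))%N -> outer_inv (j, i) ->
  exists qs x j' i', [/\ halts outer_run outer_next oracle e ((j, i), outer_run (j, i)) qs x,
    x \in qs, dnrm G (grad x) <= eps, outer_inv (j', i') &
    spent j i + (size qs)%:R <= spent j' i'.+1].
Proof.
move=> Tmax; elim=> [|n IH] j i Tn I.
  by have := Tmax _ _ I; rewrite leqNgt -[(j + i)%N]add0n Tn.
have Mj0 : 0 < M0 * 2 ^+ j by rewrite mulr_gt0 ?exprn_gt0.
have cost := outer_run_cost j i.
have [_] := runP x0 i f_grad f_cont eps0 Mj0; rewrite -/oracle.
rewrite -/(outer_run (j, i)).
case E: (outcome oracle (outer_run (j, i))) => [x|b] out.
  have [xq gx] := out.
  exists (queries oracle (outer_run (j, i))), x, j, i; split => //.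
    by apply: halts_found => //; exact: outer_run_ask.
  have -> : spent j i.+1 = spent j i + W * B ^+ i.
    by rewrite /spent big_ord_recr /= addrA mulrDr.
  by rewrite lerD2l.
have I' := outer_step I E.
have sp := spent_next j i b.
case E': (outer_next (j, i) b) I' sp => [j1 i1] I' /= sp.
have Tn' : (T < n + (j1 + i1))%N.
  apply: leq_trans Tn _; rewrite addSnnS leq_add2l.
  move: E'; rewrite /outer_next /=; case: (b) => [|] [<- <-]; first by rewrite addnS.
  by rewrite addSn ltnS leq_add2l; case: (i).
have [qs [x [j' [i' [h xq gx I'' c]]]]] := IH _ _ Tn' I'.
exists (queries oracle (outer_run (j, i)) ++ qs), x, j', i'; split => //.
- by apply: (halts_restart outer_run_ask E); rewrite E'.
- by rewrite mem_cat xq orbT.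
- rewrite size_cat natrD addrA; apply: le_trans c; rewrite lerD2r.
  by apply: le_trans sp; rewrite lerD2l.
Qed.

(** Since exp (1 / 2) <= 2, one gets exp (j / 2) <= 2 u <= (exp 1 + u) ^ 2. *)
Lemma double_count_le_ln (u : R) j : 1 <= u -> 2 ^+ j <= 2 * u ->
  j%:R <= 4 * ln (expR 1 + u).
Proof.
move=> u1 ju; have e2 : 2 <= expR 1 :> R by exact: expR_ge1Dx.
have u0 : 0 < expR 1 + u by lra.
have eh : expR 2^-1 <= 2 :> R.
  have h := @expR_ge1Dx R (- 2^-1).
  rewrite expRN (_ : 1 - 2^-1 = 2^-1) in h; last by field.
  by rewrite -lef_pV2 ?posrE ?expR_gt0.
have h1 : expR (j%:R / 2) <= (expR 1 + u) ^+ 2.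
  rewrite mulrC expRM_natr; apply: (le_trans (y := 2 ^+ j)).
    by apply: lerXn2r; rewrite ?nnegrE ?expR_ge0.
  apply: le_trans ju _; nra.
have := h1; rewrite -ler_ln ?posrE ?expR_gt0 ?exprn_gt0// expRK lnXn//.
by rewrite -mulr_natl; lra.
Qed.

(** The two invariants bound j by a logarithm and 2 ^ i by 4 K. *)
Lemma spent_le j i (D : R) : M0 <= L -> M0 * 2 ^+ j <= 2 * L ->
  ((0 < i)%N -> 2 ^+ i * eps <= 2 * (M0 * 2 ^+ j) * D) -> 0 <= D ->
  spent j i.+1 <= 16 * W * Num.max 1 (L * D / eps) `^ (m / (m + 2))
                 + 16 * W * ln (expR 1 + L / M0).
Proof.
move=> ML Mj iD D0; set K := Num.max _ _; set a := m / (m + 2).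
have LM : 1 <= L / M0 by rewrite ler_pdivlMr// mul1r.
have jl : j%:R <= 4 * ln (expR 1 + L / M0).
  by apply: double_count_le_ln => //; rewrite mulrA ler_pdivlMr// mulrC.
have K1 : 1 <= K by rewrite le_max lexx.
have iK : 2 ^+ i <= 4 * K.
  case: i iD => [_|i iD]; first by rewrite expr0; lra.
  apply: (le_trans (y := 4 * (L * D / eps))); last first.
    by rewrite ler_pM2l// le_max lexx orbT.
  rewrite !mulrA ler_pdivlMr//; apply: le_trans (iD isT) _.
  by apply: ler_wpM2r => //; lra.
have a0 : 0 <= a by have := rate_ge_half (deg_ge2 G); rewrite -/a; lra.
have Bi : B ^+ i <= 4 * K `^ a.
  rewrite -growthX; apply: le_trans (ler_powR_base a0 (exprn_ge0 _ (ler0n _ 2)) iK) _.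
  rewrite powRM ?(le_trans ler01 K1)//; apply: ler_wpM2r; first exact: powR_ge0.
  by apply: ler1_powR; [lra | exact: rate_le1 (deg_ge2 G)].
have sB := growth_sum (deg_ge2 G) i.
have := run_const_ge0; have ln0 : 0 <= ln (expR 1 + L / M0).
  by apply: ln_ge0; have := expR_ge0 (1 : R); lra.
rewrite /spent -mulrA -[16 * W * ln _]mulrA [16 * _]mulrCA [16 * (W * ln _)]mulrCA -mulrDr.
move=> W0; apply: ler_wpM2l => //.
move: jl sB Bi ln0; move: (ln _) (K `^ a) (B ^+ i) (\sum_(_ < _) _) (j%:R) => *; lra.
Qed.

(** The number D is any upper bound of all lower bounds of the distances from x0 to
    minimizers, such as their infimum. *)
Lemma outer_terminates e (D : R) : M0 <= L -> 0 <= D ->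
  (exists z, forall z', f z <= f z') ->
  (forall r, (forall z, (forall z', f z <= f z') -> r <= N (x0 - z)) -> r <= D) ->
  exists qs x,
    [/\ halts outer_run outer_next oracle e ((0%N, 0%N), outer_run (0%N, 0%N)) qs x,
        x \in qs, dnrm G (grad x) <= eps &
        (size qs)%:R <= 16 * W * Num.max 1 (L * D / eps) `^ (m / (m + 2))
                        + 16 * W * ln (expR 1 + L / M0)].
Proof.
move=> ML D0 [z zmin] Dinf; have L0 : 0 < L by exact: lt_le_trans ML.
have expn_gt k : k%:R <= 2 ^+ k :> R by rewrite -natrX ler_nat ltnW// ltn_expl.
pose T := (Num.truncn (2 * L / M0)%R + Num.truncn (4 * L * N (x0 - z) / eps)%R)%N.
have LN0 : 0 <= 4 * L * N (x0 - z) by rewrite !mulr_ge0 ?nrm_ge0// ltW.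
have Tmax j i : outer_inv (j, i) -> (j + i <= T)%N.
  move=> [/= Mj iD]; apply: leq_add.
    rewrite truncn_ge_nat ?divr_ge0 ?mulr_ge0 ?(ltW L0) ?(ltW M0_gt0)//.
    by apply: le_trans (expn_gt j) _; rewrite ler_pdivlMr// mulrC.
  case: i iD => // i /(_ isT z zmin) iD.
  rewrite truncn_ge_nat ?divr_ge0 ?(ltW eps0)//.
  apply: le_trans (expn_gt _) _; rewrite ler_pdivlMr//; apply: le_trans iD _.
  by apply: ler_wpM2r (nrm_ge0 _ _) _ _ _; lra.
have I0 : outer_inv (0%N, 0%N) by split=> //=; rewrite expr0; lra.
have [|qs [x [j [i [h xq gx [/= Mj iD] c]]]]] := outer_halts e Tmax (n := T.+1) (j := 0) (i := 0) _ I0.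
  by rewrite !addn0.
exists qs, x; split => //.
have iD' : (0 < i)%N -> 2 ^+ i * eps <= 2 * (M0 * 2 ^+ j) * D.
  move=> i0; have MM : 0 < 2 * (M0 * 2 ^+ j) by rewrite !mulr_gt0 ?exprn_gt0.
  rewrite [leRHS]mulrC -ler_pdivrMr//; apply: Dinf => u umin.
  by rewrite ler_pdivrMr// [leRHS]mulrC; exact: iD.
apply: le_trans (spent_le ML Mj iD' D0); apply: le_trans c.
by rewrite /spent big_ord0 addr0 mulr0 add0r.
Qed.

End Outer.

(** * The method *)

(** The value 0 is returned only in states that [settle] never produces when every
    run starts with a query. *)
Definition restart_protocol (R : realType) (d : nat) (J : Type)
    (runs : J -> prog 'rV[R]_d (R * 'rV[R]_d) ('rV[R]_d + bool))
    (next : J -> bool -> J) (js : J) : protocol R d :=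
  fun h => match (foldl (feed runs next) (js, runs js) h).2 with
           | Ask x _ => Query x
           | Ret (inl x) => Return x
           | Ret (inr _) => Return 0
           end.

Lemma halts_with_restart (R : realType) (d : nat) (J : Type)
    (runs : J -> prog 'rV[R]_d (R * 'rV[R]_d) ('rV[R]_d + bool))
    (next : J -> bool -> J) (js : J) O qs x :
  halts runs next O 0 (js, runs js) qs x ->
  halts_with (restart_protocol runs next js) O qs x.
Proof.
move=> [fl fin]; split => [i iq|]; rewrite /restart_protocol; last by rewrite fin.
by have [c ->] := fl i iq.
Qed.

Definition secant_method (R : realType) : method R :=
  fun p d eps x0 z0 M0 =>
    match pselect (1 < p) with
    | left p1 => restart_protocol (outer_run (lp_geometry d p1) eps x0 M0)
                   outer_next (0%N, 0%N)
    | right _ => fun _ => Return x0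
    end.

(** It depends on p alone: both the degree and the modulus of uniform convexity are
    free of the dimension. *)
Definition secant_const (R : realType) (p : R) : R :=
  16 * run_const (ucdeg p) (ucmod p).

Lemma secant_ratio_gt0 (R : realType) (p q : R) (d : nat) (f : 'rV[R]_d -> R)
    (x0 z0 : 'rV[R]_d) :
  1 <= p -> 1 <= q -> z0 <> x0 -> gradient f z0 <> gradient f x0 ->
  0 < secant_ratio p q f x0 z0.
Proof.
move=> p1 q1 zx gzx; rewrite /secant_ratio; apply: divr_gt0.
  rewrite lt_neqAle lp_norm_ge0 andbT eq_sym; apply/eqP => /(lp_norm_eq0 q1)/eqP.
  by rewrite subr_eq0 => /eqP.
rewrite lt_neqAle lp_norm_ge0 andbT eq_sym; apply/eqP => /(lp_norm_eq0 p1)/eqP.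
by rewrite subr_eq0 => /eqP.
Qed.

Lemma secant_ratio_le (R : realType) (p q L : R) (d : nat) (f : 'rV[R]_d -> R)
    (x0 z0 : 'rV[R]_d) :
  1 <= p -> z0 <> x0 ->
  lp_norm q (gradient f z0 - gradient f x0) <= L * lp_norm p (z0 - x0) ->
  secant_ratio p q f x0 z0 <= L.
Proof.
move=> p1 zx; rewrite /secant_ratio ler_pdivrMr//.
rewrite lt_neqAle lp_norm_ge0 andbT eq_sym; apply/eqP => /(lp_norm_eq0 p1)/eqP.
by rewrite subr_eq0 => /eqP.
Qed.

Lemma le_lp_dist (R : realType) (p r : R) (d : nat) (x0 : 'rV[R]_d) (A : set 'rV[R]_d) :
  1 <= p -> A !=set0 -> (forall z, A z -> r <= lp_norm p (x0 - z)) -> r <= lp_dist p x0 A.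
Proof.
move=> p1 [z Az] h; apply: lb_le_inf; first by exists (lp_norm p (z - x0)), z.
by move=> _ [u Au <-]; rewrite lp_normC//; exact: h.
Qed.

Lemma secant_methodP (R : realType) (p : R) (d : nat) (f : 'rV[R]_d -> R)
    (L eps : R) (x0 z0 : 'rV[R]_d) :
  1 < p ->
  let q := p / (p - 1) in
  objective_class p q L f -> 0 < eps -> z0 <> x0 ->
  gradient f z0 <> gradient f x0 ->
  let M0 := secant_ratio p q f x0 z0 in
  let K := L * lp_dist p x0 (argmin f) / eps in
  exists (qs : seq 'rV[R]_d) (xhat : 'rV[R]_d),
    [/\ halts_with (secant_method p eps x0 z0 M0) (pair_oracle f) qs xhat,
        xhat \in qs,
        lp_norm q (gradient f xhat) <= eps &
        (size qs)%:R <= secant_const p * Num.max 1 K `^ (ucdeg p / (ucdeg p + 2))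
          + secant_const p * ln (expR 1 + L / M0)].
Proof.
move=> p1 q [fd fc f0 fs] eps0 zx gzx; lazy zeta.
have q1 := conjugate_gt1 p1.
have M0_gt0 := secant_ratio_gt0 (ltW p1) (ltW q1) zx gzx.
have ML := secant_ratio_le (ltW p1) zx (fs z0 x0).
rewrite -/q in M0_gt0; move: (secant_ratio _ _ _ _ _) M0_gt0 ML => M0 M0_gt0 ML.
pose G := lp_geometry d p1.
have f_grad x y : f x + pair G (gradient f x) (y - x) <= f y.
  exact: convex_gradient_le.
have f_cont : continuous f by move=> x; exact: differentiable_continuous.
have D0 : 0 <= lp_dist p x0 (argmin f).
  by apply: (le_lp_dist (ltW p1) f0) => z _; exact: lp_norm_ge0.
have Dinf r : (forall z, (forall z', f z <= f z') -> r <= nrm G (x0 - z)) ->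
    r <= lp_dist p x0 (argmin f).
  by move=> h; apply: (le_lp_dist (ltW p1) f0) => z zmin; exact: h.
have [qs [x [h xq gx c]]] := outer_terminates f_grad f_cont fs eps0 M0_gt0 0 ML D0 f0 Dinf.
exists qs, x; split; [|exact: xq|exact: gx|exact: c].
rewrite /secant_method; case: pselect => [p1'|/(_ p1)//]; rewrite (Prop_irrelevance p1' p1).
exact: halts_with_restart h.
Qed.

Theorem theorem2p3 (R : realType) :
  exists (A : method R) (C : R) (Cp : R -> R),
  forall (p : R), 1 < p ->
  let q := p / (p - 1) in
  forall (d : nat) (f : 'rV[R]_d -> R) (L eps : R) (x0 z0 : 'rV[R]_d),
  objective_class p q L f ->
  0 < eps ->
  z0 <> x0 ->
  gradient f z0 <> gradient f x0 ->
  let M0 := secant_ratio p q f x0 z0 in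
  let K := L * lp_dist p x0 (argmin f) / eps in
  let Kbar := Num.max 1 K in
  exists (qs : seq 'rV[R]_d) (xhat : 'rV[R]_d),
    let N := (size qs)%:R : R in
    [/\ halts_with (A p d eps x0 z0 M0) (pair_oracle f) qs xhat,
        xhat \in qs,
        lp_norm q (gradient f xhat) <= eps &
        [/\ (p < 2 ->
             N <= Cp p * Kbar `^ (1 / 2) + Cp p * ln (expR 1 + L / M0)),
            (p = 2 ->
             N <= C * Kbar `^ (1 / 2) + C * ln (expR 1 + L / M0)) &
            (2 < p ->
             N <= Cp p * Kbar `^ (p / (p + 2))
                  + Cp p * ln (expR 1 + L / M0))]].
Proof.
exists (@secant_method R), (secant_const 2), (@secant_const R).
move=> p p1 q d f L eps x0 z0 fobj eps0 zx gzx M0 K Kbar.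
have [qs [x [h xq gx c]]] := secant_methodP p1 fobj eps0 zx gzx.
have half : 2 / (2 + 2) = 1 / 2 :> R by field.
exists qs, x; split; [exact: h|exact: xq|exact: gx|split => p2].
- have e := ucdeg_le2 (ltW p2).
  by rewrite e half in c; exact: c.
- have e : ucdeg p = 2 by rewrite p2; exact: ucdeg_le2.
  have -> : secant_const 2 = secant_const p by rewrite p2.
  by rewrite e half in c; exact: c.
- have e := ucdeg_id (ltW p2).
  by rewrite e in c; exact: c.
Qed.
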